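(* Let $q$ be a power of a prime $p$, let $n\geq 2$, and let $X=\{F=0\}\subset\mathbb{P}^n$ be a smooth Frobenius nonclassical hypersurface over $\mathbb{F}_q$ of degree $d\geq 2$. Then $d\leq q+2$, and moreover: (1) $d=q+1$ and $n$ is odd if and only if there exists a nondegenerate skew-symmetric $(n+1)\times(n+1)$ matrix $(A_{ij})$ with entries in $\mathbb{F}_q$ and zero diagonal such that $F=\sum_{i,j=0}^n x_i^qA_{ij}x_j$. (2) $d=q+1$ and $n$ is even if and only if $p=2$ and, up to the action of $\mathrm{PGL}_{n+1}(\mathbb{F}_q)$ on coordinates, $F_{1,0}=x_0^{q-1}F$ and $F=x_0G+\sum_{i,j=1}^n x_i^qB_{ij}x_j$, where $G$ is a polynomial with $\frac{\partial G}{\partial x_0}=0$ and $(B_{ij})_{1\leq i,j\leq n}$ is a nondegenerate skew-symmetric matrix with entries in $\mathbb{F}_q$ and zero diagonal. (3) $d=q+2$ if and only if $p=n=2$ and, after rescaling $F$ by a nonzero constant, $F=x_0x_1x_2(x_0^{q-1}+x_1^{q-1}+x_2^{q-1})+G(x_0^2,x_1^2,x_2^2)$ for some polynomial $G$. Furthermore, condition (1) or condition (3) occurs if and only if $F_{1,0}$ is the zero polynomial.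
   Context: A hypersurface $X=\{F=0\}\subset\mathbb{P}^n$ over $\mathbb{F}_q$ is given by a nonzero homogeneous polynomial $F\in\mathbb{F}_q[x_0,\dots,x_n]$. Define $F_{1,0}:=\sum_{i=0}^n x_i^q\frac{\partial F}{\partial x_i}$. $X$ is called Frobenius nonclassical (over $\mathbb{F}_q$) if $F$ divides $F_{1,0}$; equivalently, the $q$-th Frobenius map sends every $\overline{\mathbb{F}_q}$-point $P\in X$ into the embedded tangent space $T_PX$. *)

(* Defs.v *)
From HB Require Import structures.
From mathcomp Require Import all_boot all_order all_algebra.
From mathcomp Require Import mpoly.
Set Implicit Arguments. Unset Strict Implicit. Unset Printing Implicit Defensive.
Import GRing.Theory.
Local Open Scope ring_scope.

Definition frob10 (K : fieldType) (n q : nat) (F : {mpoly K[n]}) : {mpoly K[n]} :=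
  \sum_(i < n) 'X_i ^+ q * F^`M(i).

Definition frobenius_nonclassical (K : fieldType) (n q : nat) (F : {mpoly K[n]}) : Prop :=
  exists H : {mpoly K[n]}, frob10 q F = H * F.

Definition smooth_hypersurface (K : fieldType) (n : nat) (F : {mpoly K[n]}) : Prop :=
  forall (L : closedFieldType) (iota : {rmorphism K -> L}) (x : 'I_n -> L),
    (exists i, x i != 0) ->
    ~ ((map_mpoly iota F).@[x] = 0 /\
       forall i : 'I_n, (map_mpoly iota (F^`M(i))).@[x] = 0).

Definition skew_zero_diag (K : fieldType) (m : nat) (A : 'M[K]_m) : Prop :=
  A^T = - A /\ forall i, A i i = 0.

Definition frob_form (K : fieldType) (m q : nat) (A : 'M[K]_m) : {mpoly K[m]} :=
  \sum_(i < m) \sum_(j < m) 'X_i ^+ q * (A i j)%:MP * 'X_j.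

Definition frob_form_tail (K : fieldType) (n q : nat) (B : 'M[K]_n) : {mpoly K[n.+1]} :=
  \sum_(i < n) \sum_(j < n)
     'X_(lift ord0 i) ^+ q * (B i j)%:MP * 'X_(lift ord0 j).

Definition lin_subst (K : fieldType) (m : nat) (M : 'M[K]_m) (F : {mpoly K[m]}) : {mpoly K[m]} :=
  F \mPo [tuple \sum_(j < m) (M i j)%:MP * 'X_j | i < m].

Definition sq_subst (K : fieldType) (m : nat) (G : {mpoly K[m]}) : {mpoly K[m]} :=
  G \mPo [tuple 'X_i ^+ 2 | i < m].

(* Main.v *)
Require Import Defs.
From HB Require Import structures.
From Stdlib Require Import ClassicalEpsilon.
From mathcomp Require Import all_boot all_order all_algebra all_solvable all_field.
From mathcomp Require Import zify ring mpoly.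
Set Implicit Arguments. Unset Strict Implicit. Unset Printing Implicit Defensive.
Import GRing.Theory.
Local Open Scope ring_scope.

(** Write F_i for the partial derivatives, H for the quotient F_{1,0} / F.

Smoothness makes the ideal (F, F_0, ..., F_n) contain a power of every
variable, so by depth sensitivity the Koszul homology of a family of m
generators of such an ideal vanishes above degree m - (n + 1).

If p does not divide d, Euler's formula puts F in the ideal of the F_i and
turns F | F_{1,0} into the syzygy x_i^q - (H/d) x_i of the F_i.  It is a
Koszul syzygy sum_l A_il F_l with A alternating of degree q + 1 - d, whence
d <= q + 1.  For d = q + 1 the matrix A is constant.  If A is invertible, then
n is odd and solving for the F_i gives F = sum x_i^q B_ij x_j.  A kernel vector
of A gives a linear form l over F_q with l^q = H l, so H = l^(q-1); in
coordinates with l = x_0, comparing mixed partials forces 2 = 0.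

If p divides d, then sum x_i F_i = 0 and the minors x_i x_j^q - x_j x_i^q
complete to a 2-cycle on the n + 2 generators F, F_0, ..., F_n.  It is a
boundary, so d <= q + 2, and for d = q + 2 the n (n + 1) / 2 independent minors
lie in the span of the n + 1 partials: n = 2 and the F_i are the minors up to
a constant. *)

(** * Closed points of proper ideals *)

Definition classicb (P : Prop) : bool := excluded_middle_informative P.

Lemma classicP (P : Prop) : reflect P (classicb P).
Proof.
by rewrite /classicb; case: excluded_middle_informative => ?; constructor.
Qed.

Section MaximalIdeal.

Local Open Scope quotient_scope.

Variable R : countComNzRingType.
Implicit Types (S : {pred R}) (r x : R).

Definition adjoin S r : {pred R} :=
  [pred x | classicb (exists b, x - b * r \in S)].

Lemma adjoinP S r x : reflect (exists b, x - b * r \in S) (x \in adjoin S r).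
Proof. by rewrite inE; apply: classicP. Qed.

Lemma sub_adjoin S r x : x \in S -> x \in adjoin S r.
Proof. by move=> Sx; apply/adjoinP; exists 0; rewrite mul0r subr0. Qed.

Lemma idealr_closed_adjoin S r :
  idealr_closed S -> 1 \notin adjoin S r -> idealr_closed (adjoin S r).
Proof.
move=> [S0 _ SD] proper; split=> //; first exact: sub_adjoin.
move=> a x y /adjoinP[b Sx] /adjoinP[c Sy]; apply/adjoinP; exists (a * b + c).
by rewrite mulrDl opprD addrACA -mulrA -mulrBr; apply: SD.
Qed.

Lemma mem_adjoin S r : 0 \in S -> r \in adjoin S r.
Proof. by move=> S0; apply/adjoinP; exists 1; rewrite mul1r subrr. Qed.

Variable S : {pred R}.
Hypothesis idealS : idealr_closed S.

Fixpoint ideal_chain k : {pred R} :=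
  if k is k'.+1 then
    let T := adjoin (ideal_chain k') (odflt 0 (unpickle k')) in
    if 1 \in T then ideal_chain k' else T
  else S.

Lemma idealr_closed_chain k : idealr_closed (ideal_chain k).
Proof.
by elim: k => //= k IHk; case: ifPn => // proper; apply: idealr_closed_adjoin.
Qed.

Lemma ideal_chain_homo k l x :
  (k <= l)%N -> x \in ideal_chain k -> x \in ideal_chain l.
Proof.
move/subnKC <-; elim: (l - k)%N => [|j IHj] Tx; first by rewrite addn0.
by rewrite addnS /=; case: ifP => _; rewrite ?sub_adjoin // IHj.
Qed.

Definition max_ideal : {pred R} :=
  [pred x | classicb (exists k, x \in ideal_chain k)].

Lemma max_idealP x : reflect (exists k, x \in ideal_chain k) (x \in max_ideal).
Proof. by rewrite inE; apply: classicP. Qed.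

Lemma idealr_closed_max : idealr_closed max_ideal.
Proof.
split.
- by apply/max_idealP; exists 0; case: idealS.
- by apply/max_idealP => -[k]; have [_ /negP] := idealr_closed_chain k.
move=> a x y /max_idealP[k Tx] /max_idealP[l Ty]; apply/max_idealP.
exists (maxn k l); have [_ _ TD] := idealr_closed_chain (maxn k l).
by apply: TD; [apply: ideal_chain_homo Tx|apply: ideal_chain_homo Ty];
  rewrite ?leq_maxl ?leq_maxr.
Qed.

Lemma sub_max_ideal x : x \in S -> x \in max_ideal.
Proof. by move=> Sx; apply/max_idealP; exists 0. Qed.

Lemma max_ideal_inverse r :
  r \notin max_ideal -> exists s, 1 - s * r \in max_ideal.
Proof.
move=> nMr; set k := pickle r; have [T0 _ _] := idealr_closed_chain k.
have [/adjoinP[s Ts]|proper] := boolP (1 \in adjoin (ideal_chain k) r).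
  by exists s; apply/max_idealP; exists k.
case/max_idealP: nMr; exists k.+1.
by rewrite /= pickleK (negPf proper) mem_adjoin.
Qed.

Theorem proper_ideal_closed_point :
  exists (L : closedFieldType) (phi : {rmorphism R -> L}),
    {in S, forall x, phi x = 0}.
Proof.
pose I : idealr R :=
  HB.pack max_ideal (isIdealr.Build R max_ideal idealr_closed_max).
pose Q : comNzRingType := {ideal_quot I}.
pose pi : {rmorphism R -> Q} := \pi_({ideal_quot I}).
have pi_eq0 x : (pi x == 0) = (x \in max_ideal).
  have := Quotient.idealrBE I x 0; rewrite subr0 => ->.
  by rewrite -(rmorph0 pi).
have has_inverse (u : Q) : exists v, (u != 0) ==> (v * u == 1).
  have [r <-] : exists r, pi r = u by exists (repr u); exact: reprK.
  rewrite pi_eq0; case: (boolP (r \in _)) => [_|/max_ideal_inverse[s]].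
    by exists 0.
  by rewrite -pi_eq0 rmorphB rmorph1 rmorphM subr_eq0 eq_sym; exists (pi s).
have [invq mulVq] : exists invq : Q -> Q, forall u, u != 0 -> invq u * u = 1.
  exists (fun u => xchoose (has_inverse u)) => u u_neq0.
  exact/eqP/(implyP (xchooseP (has_inverse u))).
pose inv u := if u == 0 then 0 else invq u.
have mulVf u : u != 0 -> inv u * u = 1.
  by move=> u_neq0; rewrite /inv (negPf u_neq0) mulVq.
have inv0 : inv 0 = 0 by rewrite /inv eqxx.
pose F : countFieldType := HB.pack Q
  (Countable.copy Q (can_type (@reprK _ {ideal_quot I})))
  (GRing.ComNzRing_isField.Build Q mulVf inv0).
have [L [f _]] := countable_algebraic_closure F.
exists L, (f \o (pi : {rmorphism R -> F})) => x /sub_max_ideal.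
by rewrite -pi_eq0 => /eqP /= ->; rewrite rmorph0.
Qed.

End MaximalIdeal.

(** * Koszul homology *)

(* Elements of an exterior algebra are encoded by their coefficients on index
   sequences; the degree d part is read on the sequences of length d. *)
Definition alternating (I : Type) (V : zmodType) (w : seq I -> V) : Prop :=
  (forall s t i, w (s ++ [:: i, i & t]) = 0) /\
  (forall s t i j, w (s ++ [:: i, j & t]) = - w (s ++ [:: j, i & t])).

Section AlternatingFunctions.

Variables (I : eqType) (V : zmodType).
Implicit Types (w : seq I -> V) (s t : seq I) (i j : I).

Lemma alternating_cons w i : alternating w -> alternating (fun s => w (i :: s)).
Proof.
by move=> [w0 wN]; split=> s; [exact: (w0 (i :: s))|exact: (wN (i :: s))].
Qed.

Lemma alternating0 : alternating (fun _ : seq I => 0 : V).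
Proof. by split=> // *; rewrite oppr0. Qed.

Lemma alternatingB w1 w2 :
  alternating w1 -> alternating w2 -> alternating (fun s => w1 s - w2 s).
Proof.
move=> [w10 w1N] [w20 w2N]; split=> s t i; first by rewrite w10 w20 subrr.
by move=> j; rewrite w1N w2N opprD.
Qed.

Lemma alternating_raddf (W : zmodType) (phi : {additive V -> W}) w :
  alternating w -> alternating (phi \o w).
Proof.
move=> [w0 wN]; split=> s t i /=; first by rewrite w0 raddf0.
by move=> j; rewrite wN raddfN.
Qed.

Lemma alternating_map (J : eqType) (h : J -> I) w :
  alternating w -> alternating (w \o map h).
Proof.
by move=> [w0 wN]; split=> s t i; [|move=> j]; rewrite /= !map_cat ?w0 //= wN.
Qed.

Lemma alternating_nonuniq w s : alternating w -> ~~ uniq s -> w s = 0.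
Proof.
move=> [w0 wN].
have swap s1 s2 s3 i : w (s1 ++ i :: s2 ++ i :: s3) = 0.
  elim: s2 s1 => [|j s2 IHs] s1 /=; first exact: w0.
  by rewrite wN -cat_rcons IHs oppr0.
suff with_prefix s0 : ~~ uniq s -> w (s0 ++ s) = 0 by exact: (with_prefix [::]).
elim: s s0 => // i s IHs s0 /=.
rewrite negb_and negbK => /orP[/splitPr[s1 s2]|/IHs]; first exact: swap.
by rewrite -cat_rcons => ->.
Qed.

Definition fun_seq1 (c : I -> V) s : V := if s is [:: i] then c i else 0.

Definition fun_seq2 (c : I -> I -> V) s : V :=
  if s is [:: i; j] then c i j else 0.

Lemma alternating_fun_seq1 c : alternating (fun_seq1 c).
Proof. by split=> [[|i [|j s]]|[|i [|j s]]] //= *; rewrite oppr0. Qed.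

Lemma alternating_fun_seq2 c : (forall i, c i i = 0) ->
  (forall i j, c i j = - c j i) -> alternating (fun_seq2 c).
Proof.
move=> c0 cN; split=> [[|i [|j [|k s]]] [|l t]|[|i [|j [|k s]]] [|l t]] //= *;
  by rewrite oppr0.
Qed.

End AlternatingFunctions.

Lemma sum_alternating (V : zmodType) (I : finType) (S : I -> I -> V) :
  (forall i, S i i = 0) -> (forall i j, S i j = - S j i) ->
  \sum_i \sum_j S i j = 0.
Proof.
move=> S0 SN; pose below (u : I * I) := (enum_rank u.1 < enum_rank u.2)%N.
pose swap (u : I * I) := (u.2, u.1).
rewrite pair_big /= (bigID below) /= [X in _ + X](bigID (below \o swap)) /=.
rewrite [X in _ + (_ + X)]big1 ?addr0 => [|[i j]]; last first.
  rewrite /below /= -!leqNgt => /andP[ge_ij ge_ji].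
  by have /val_inj/enum_rank_inj ->
    := anti_leq (introT andP (conj ge_ij ge_ji)).
rewrite [X in _ + X](reindex_inj (h := swap)) /= => [|[i j] [k l] [-> ->] //].
rewrite [X in _ + X](eq_bigl below) => [|[i j]]; last first.
  by rewrite /below /=; case: ltngtP.
by rewrite -big_split big1 // => -[i j] _ /=; rewrite SN addNr.
Qed.

Section GeneratedIdeal.

Variables (R : comNzRingType) (I : finType) (f : I -> R).
Implicit Types (x y : R) (i : I).

Definition ideal_of x : Prop := exists a : I -> R, x = \sum_i a i * f i.

Lemma ideal_of0 : ideal_of 0.
Proof. by exists (fun=> 0); rewrite big1 // => i _; rewrite mul0r. Qed.

Lemma ideal_ofD x y : ideal_of x -> ideal_of y -> ideal_of (x + y).
Proof.
move=> [a ->] [b ->]; exists (fun i => a i + b i); rewrite -big_split.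
by apply: eq_bigr => i _; rewrite mulrDl.
Qed.

Lemma ideal_ofM x y : ideal_of y -> ideal_of (x * y).
Proof.
move=> [a ->]; exists (fun i => x * a i); rewrite mulr_sumr.
by apply: eq_bigr => i _; rewrite mulrA.
Qed.

Lemma ideal_ofB x y : ideal_of x -> ideal_of y -> ideal_of (x - y).
Proof. by move=> Jx Jy; rewrite -mulN1r; apply/ideal_ofD/ideal_ofM. Qed.

Lemma ideal_of_sum (T : finType) (x : T -> R) :
  (forall t, ideal_of (x t)) -> ideal_of (\sum_t x t).
Proof. by move=> Jx; elim/big_ind: _; [exact: ideal_of0|exact: ideal_ofD|]. Qed.

Lemma mem_ideal_of i : ideal_of (f i).
Proof.
exists (fun j => (j == i)%:R).
rewrite (big_only1 i) ?eqxx ?mul1r // => j /negPf ->.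
by rewrite mul0r.
Qed.

End GeneratedIdeal.

Lemma ideal_of_trans (R : comNzRingType) (I J : finType) (f : I -> R)
    (g : J -> R) x :
  (forall i, ideal_of g (f i)) -> ideal_of f x -> ideal_of g x.
Proof. by move=> fg [a ->]; apply: ideal_of_sum => i; apply: ideal_ofM. Qed.

Lemma ideal_of_prefixS (R : comNzRingType) (g : nat -> R) k x :
  ideal_of (fun i : 'I_k => g i) x -> ideal_of (fun i : 'I_k.+1 => g i) x.
Proof.
apply: ideal_of_trans => i.
exact: (mem_ideal_of (fun i : 'I_k.+1 => g i) (widen_ord (leqnSn k) i)).
Qed.

Section Koszul.

Variables (R : comNzRingType) (I : finType) (f : I -> R).
Implicit Types (w : seq I -> R) (s : seq I) (a : I -> R) (i j l : I).

Definition koszul w s : R := \sum_i f i * w (i :: s).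

Fixpoint wedge l w s : R :=
  if s is i :: s' then (i == l)%:R * w s' - wedge l (fun t => w (i :: t)) s'
  else 0.

Definition wedge_comb a w s : R := \sum_l a l * wedge l w s.

Lemma alternating_comb (T : finType) (a : T -> R) (w : T -> seq I -> R) :
  (forall t, alternating (w t)) -> alternating (fun s => \sum_t a t * w t s).
Proof.
move=> alt_w; split=> [s t i|s t i j].
  by rewrite big1 // => u _; rewrite (alt_w u).1 mulr0.
by rewrite -sumrN; apply: eq_bigr => u _; rewrite (alt_w u).2 mulrN.
Qed.

Lemma eq_wedge l w1 w2 : w1 =1 w2 -> wedge l w1 =1 wedge l w2.
Proof.
move=> eq_w s; elim: s w1 w2 eq_w => //= i s IHs w1 w2 eq_w.
by rewrite eq_w (IHs _ (fun t => w2 (i :: t))).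
Qed.

Lemma wedge_sum l (T : finType) (a : T -> R) (w : T -> seq I -> R) s :
  wedge l (fun s => \sum_t a t * w t s) s = \sum_t a t * wedge l (w t) s.
Proof.
elim: s w => [|i s IHs] w /=; first by rewrite big1 // => t _; rewrite mulr0.
rewrite (IHs (fun t s => w t (i :: s))) mulr_sumr -sumrB; apply: eq_bigr => t _.
by rewrite mulrBr mulrCA.
Qed.

Lemma wedge0 l s : wedge l (fun=> 0) s = 0.
Proof. by elim: s => //= i s ->; rewrite mulr0 subr0. Qed.

Lemma wedgeN l w s : wedge l (fun s => - w s) s = - wedge l w s.
Proof.
by elim: s w => [|i s IHs] w /=; rewrite ?oppr0 // IHs mulrN opprB opprK addrC.
Qed.

Lemma alternating_wedge l w : alternating w -> alternating (wedge l w).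
Proof.
move=> alt_w; split=> s t i.
  elim: s w alt_w => [|x s IHs] w alt_w /=.
    by rewrite (eq_wedge l (fun s => alt_w.1 [::] s i)) wedge0 subr0 subrr.
  by rewrite alt_w.1 mulr0 sub0r IHs ?oppr0 //; apply: alternating_cons.
move=> j; elim: s w alt_w => [|x s IHs] w alt_w /=.
  by rewrite (eq_wedge l (fun s => alt_w.2 [::] s i j)) wedgeN !opprB addrA.
by rewrite alt_w.2 IHs ?opprD ?mulrN //; apply: alternating_cons.
Qed.

Lemma koszul_koszul w s : alternating w -> koszul (koszul w) s = 0.
Proof.
move=> [w0 wN]; rewrite /koszul; under eq_bigr do rewrite mulr_sumr.
apply: sum_alternating => [i|i j]; first by rewrite (w0 [::]) !mulr0.
by rewrite (wN [::]) !mulrN mulrCA.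
Qed.

Lemma koszul_wedge l w s :
  koszul (wedge l w) s = f l * w s - wedge l (koszul w) s.
Proof.
rewrite /koszul /= (wedge_sum l f (fun i s => w (i :: s))).
under eq_bigr do rewrite mulrBr; rewrite sumrB; congr (_ - _).
rewrite (big_only1 l) ?eqxx ?mul1r // => i /negPf ->.
by rewrite mul0r mulr0.
Qed.

Lemma koszul_wedge_comb a w s :
  koszul (wedge_comb a w) s
  = (\sum_l a l * f l) * w s - wedge_comb a (koszul w) s.
Proof.
rewrite [in LHS]/koszul /wedge_comb; under eq_bigr do rewrite mulr_sumr.
rewrite exchange_big mulr_suml -sumrB; apply: eq_bigr => l _ /=.
rewrite -mulrA -mulrBr -koszul_wedge mulr_sumr; apply: eq_bigr => i _.
by rewrite mulrCA.
Qed.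

Lemma alternating_wedge_comb a w :
  alternating w -> alternating (wedge_comb a w).
Proof.
by move=> alt_w; apply: alternating_comb => l; apply: alternating_wedge.
Qed.

Lemma alternating_koszul w : alternating w -> alternating (koszul w).
Proof.
by move=> alt_w; apply: alternating_comb => i; apply: alternating_cons.
Qed.

Lemma koszulB w1 w2 s :
  koszul (fun s => w1 s - w2 s) s = koszul w1 s - koszul w2 s.
Proof. by rewrite -sumrB; apply: eq_bigr => i _; rewrite mulrBr. Qed.

Lemma ideal_of_wedge (T : finType) (g : T -> R) l w s :
  (forall t, size s = (size t).+1 -> ideal_of g (w t)) ->
  ideal_of g (wedge l w s).
Proof.
elim: s w => [|i s IHs] w Jw /=; first exact: ideal_of0.
apply: ideal_ofB; first by apply/ideal_ofM/Jw.
by apply: IHs => t size_s; apply: Jw; rewrite /= size_s.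
Qed.

Section RegularSequence.

(* Division by g k is additive so that it preserves alternating functions. *)
Variables (N : nat) (g : nat -> R) (quo : nat -> {additive R -> R}).
Local Notation prefix_ideal k := (ideal_of (fun i : 'I_k => g i)).

Hypothesis g_regular : forall k x, (k < N)%N ->
  prefix_ideal k (g k * x) -> prefix_ideal k x.
Hypothesis quoP : forall k x, (k < N)%N ->
  prefix_ideal k.+1 x -> prefix_ideal k (x - g k * quo k x).
Hypothesis g_in : forall k, (k < N)%N -> ideal_of f (g k).

Definition koszul_exact_at k d : Prop := forall w, alternating w ->
  (forall s, (size s).+1 = d -> prefix_ideal k (koszul w s)) ->
  exists2 v, alternating v &
    forall s, size s = d -> prefix_ideal k (w s - koszul v s).

Lemma koszul_exact_above k d : (#|I| < d)%N -> koszul_exact_at k d.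
Proof.
move=> lt_d w alt_w _; exists (fun=> 0) => [|s size_s];
  first exact: alternating0.
rewrite alternating_nonuniq // /koszul ?big1 ?subr0 => [|i _|]; last 2 first.
- by rewrite mulr0.
- by apply: contraL lt_d => /card_uniqP card_s;
    rewrite -leqNgt -size_s -card_s max_card.
exact: ideal_of0.
Qed.

(* Multiplication by g k is injective modulo the prefix ideal, and zero on
   homology since g k lies in the ideal of the f i. *)
Lemma koszul_exact_regular k d : (k < N)%N ->
  koszul_exact_at k.+1 d.+1 -> koszul_exact_at k d.
Proof.
move=> lt_k exact_above w alt_w closed_w; have [a g_a] := g_in lt_k.
pose eta := wedge_comb a w.
have koszul_eta s : size s = d -> prefix_ideal k (g k * w s - koszul eta s).
  move=> size_s; rewrite koszul_wedge_comb -g_a subKr; apply: ideal_of_sum => i.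
  by apply/ideal_ofM/ideal_of_wedge => t; rewrite size_s => /esym;
    apply: closed_w.
have [||zeta alt_zeta eta_zeta] := exact_above eta.
- exact: alternating_wedge_comb.
- move=> s [size_s]; rewrite -[koszul eta s](subKr (g k * w s)).
  apply: ideal_ofB.
    by rewrite mulrC; apply/ideal_ofM/(mem_ideal_of _ (ord_max : 'I_k.+1)).
  exact/ideal_of_prefixS/koszul_eta.
pose xi s := eta s - koszul zeta s.
exists (quo k \o xi) => [|s size_s].
  apply/alternating_raddf/alternatingB; first exact: alternating_wedge_comb.
  exact: alternating_koszul.
apply: (g_regular lt_k).
have -> : g k * (w s - koszul (quo k \o xi) s)
    = (g k * w s - koszul eta s)
      + \sum_i f i * (xi (i :: s) - g k * quo k (xi (i :: s))).
  have koszul_xi : koszul eta s = koszul xi s.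
    by rewrite koszulB koszul_koszul ?subr0.
  rewrite koszul_xi mulrBr -addrA; congr (_ + _).
  under eq_bigr do rewrite mulrBr mulrCA.
  by rewrite sumrB addKr /koszul mulr_sumr.
apply: ideal_ofD; first exact: koszul_eta.
by apply: ideal_of_sum => i; apply/ideal_ofM/quoP/eta_zeta => //=;
  rewrite size_s.
Qed.

Theorem koszul_exact k d : (k <= N)%N -> (#|I| < d + (N - k))%N ->
  koszul_exact_at k d.
Proof.
move=> le_k; move: {2}(N - k)%N (erefl (N - k)%N) => c.
elim: c k d le_k => [|c IHc] k d le_k def_c; rewrite def_c.
  by rewrite addn0; apply: koszul_exact_above.
have lt_k : (k < N)%N by rewrite -subn_gt0 def_c.
have def_cS : (N - k.+1)%N = c by rewrite subnS def_c.
move=> lt_d; apply: (koszul_exact_regular lt_k); apply: IHc => //.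
by rewrite def_cS addSnnS.
Qed.

End RegularSequence.

End Koszul.

(** * Monomial regular sequences *)

Section MonomialQuotient.

Variables (R : nzRingType) (n : nat) (u : 'X_{1..n}).
Implicit Types (p : {mpoly R[n]}) (m : 'X_{1..n}).

Lemma mcoeff_mulX p m : (p * 'X_[u])@_m = if (u <= m)%MM then p@_(m - u) else 0.
Proof.
case: ifPn => [le_um|]; first by rewrite -[in LHS](submK le_um) addmC mcoeffMX.
apply: contraNeq; rewrite -mcoeff_msupp (perm_mem (msuppMX _ _)).
by case/mapP => m' _ ->; apply: lem_addr.
Qed.

Definition monomial_quo p : {mpoly R[n]} :=
  \sum_(m <- msupp p | (u <= m)%MM) p@_m *: 'X_[m - u].

Lemma mcoeff_monomial_quo p m : (monomial_quo p)@_m = p@_(m + u).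
Proof.
have shift m' : (u <= m')%MM && (m' - u == m)%MM = (m' == m + u)%MM.
  apply/andP/eqP => [[le_u /eqP <-]|->]; first by rewrite submK.
  by rewrite lem_addl addmK.
rewrite raddf_sum /=; under eq_bigr do rewrite mcoeffZ mcoeffX mulr_natr mulrb.
rewrite -big_mkcondr; under eq_bigl do rewrite shift.
case: (boolP (m + u \in msupp p)%MM) => [mu_in|mu_out].
  by rewrite -big_filter (filter_pred1_uniq (msupp_uniq p) mu_in) big_seq1.
rewrite (memN_msupp_eq0 mu_out) big_seq_cond big1 // => m' /andP[+ /eqP eq_m'].
by rewrite eq_m' (negPf mu_out).
Qed.

Lemma monomial_quo_is_zmod_morphism : zmod_morphism monomial_quo.
Proof.
by move=> p1 p2; apply/mpolyP => m;
  rewrite mcoeffB !mcoeff_monomial_quo mcoeffB.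
Qed.

HB.instance Definition _ :=
  GRing.isZmodMorphism.Build {mpoly R[n]} {mpoly R[n]} monomial_quo
    monomial_quo_is_zmod_morphism.

Lemma mcoeff_sub_monomial_quo p m :
  (p - monomial_quo p * 'X_[u])@_m = if (u <= m)%MM then 0 else p@_m.
Proof.
rewrite mcoeffB mcoeff_mulX mcoeff_monomial_quo.
by case: ifP => [/submK ->|]; rewrite ?subrr ?subr0.
Qed.

End MonomialQuotient.

Section MonomialIdeal.

Variables (R : comNzRingType) (n : nat) (u : nat -> 'X_{1..n}).
Implicit Types p : {mpoly R[n]}.
Local Notation prefix_ideal k := (ideal_of (fun i : 'I_k => 'X_[R, u i])).

Definition monomial_support k p : Prop :=
  {in msupp p, forall m, exists i : 'I_k, (u i <= m)%MM}.

Lemma monomial_support_sub_quo k p : monomial_support k.+1 p ->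
  monomial_support k (p - monomial_quo (u k) p * 'X_[u k]).
Proof.
move=> supp_p m; rewrite mcoeff_msupp mcoeff_sub_monomial_quo.
case: ifPn => [|not_le]; first by rewrite eqxx.
rewrite -mcoeff_msupp => /supp_p[i]; case: (unliftP ord_max i) => [j|] ->.
  by rewrite lift_max; exists j.
by rewrite /= (negPf not_le).
Qed.

Lemma monomial_idealP k p : prefix_ideal k p <-> monomial_support k p.
Proof.
split=> [[a ->] m|].
  rewrite mcoeff_msupp raddf_sum.
  have [/existsP //|] := boolP [exists i : 'I_k, (u i <= m)%MM].
  rewrite negb_exists => /forallP not_le; rewrite big1 ?eqxx // => i _ /=.
  by rewrite mcoeff_mulX (negPf (not_le i)).
elim: k p => [|k IHk] p supp_p.
  suff /eqP -> : p == 0 by exact: ideal_of0.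
  move: supp_p; rewrite /monomial_support -msupp_eq0.
  by case: msupp => // m s /(_ m (mem_head _ _))[[]].
rewrite -[p](subrK (monomial_quo (u k) p * 'X_[u k])); apply: ideal_ofD.
  apply: (@ideal_of_prefixS _ (fun i => 'X_[u i])).
  exact/IHk/monomial_support_sub_quo.
exact/ideal_ofM/(mem_ideal_of (fun i : 'I_k.+1 => 'X_[u i]) ord_max).
Qed.

Lemma monomial_ideal_quo k p : prefix_ideal k.+1 p ->
  prefix_ideal k (p - 'X_[u k] * monomial_quo (u k) p).
Proof.
move=> /monomial_idealP supp_p; apply/monomial_idealP.
by rewrite mulrC; apply: monomial_support_sub_quo.
Qed.

Lemma monomial_ideal_regular k p :
  (forall (i : 'I_k) m, (u i <= u k + m)%MM -> (u i <= m)%MM) ->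
  prefix_ideal k ('X_[u k] * p) -> prefix_ideal k p.
Proof.
move=> coprime_u /monomial_idealP supp_Xp; apply/monomial_idealP => m m_in.
have /supp_Xp[i /coprime_u] : (u k + m)%MM \in msupp ('X_[u k] * p).
  by rewrite mcoeff_msupp mulrC mcoeffMX -mcoeff_msupp.
by exists i.
Qed.

End MonomialIdeal.

Theorem koszul_mpoly_exact (R : comNzRingType) (n M : nat) (I : finType)
    (f : I -> {mpoly R[n]}) (d : nat) (w : seq I -> {mpoly R[n]}) :
  (forall i, ideal_of f ('X_i ^+ M)) -> (#|I| < d + n)%N -> alternating w ->
  (forall s, (size s).+1 = d -> koszul f w s = 0) ->
  exists2 v, alternating v & forall s, size s = d -> w s = koszul f v s.
Proof.
move=> f_in lt_d alt_w closed_w.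
pose u k : 'X_{1..n} := [multinom ((i == k :> nat) * M)%N | i < n].
have [|||||s size_s|v alt_v w_v] := @koszul_exact _ I f n (fun k => 'X_[u k])
    (fun k => monomial_quo (u k)) _ _ _ 0 d _ _ w alt_w.
- move=> k p lt_k; apply: monomial_ideal_regular => i m /mnm_lepP le_i.
  apply/mnm_lepP => j; have := le_i j; rewrite mnmDE !mnmE.
  by case: eqP => // ->; rewrite (ltn_eqF (ltn_ord i)).
- by move=> k p _; apply: monomial_ideal_quo.
- move=> k lt_k; have <- : 'X_(Ordinal lt_k) ^+ M = 'X_[u k] :> {mpoly R[n]}.
    by rewrite mpolyXn; congr 'X_[_]; apply/mnmP => i;
      rewrite mulmnE mnm1E mnmE eq_sym.
  exact: f_in.
- by [].
- by rewrite subn0.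
- by rewrite closed_w //; apply: ideal_of0.
exists v => // s /w_v[a]; rewrite big_ord0 => /eqP.
by rewrite subr_eq0 => /eqP.
Qed.

(** * Nullstellensatz *)

Section CountableMpoly.

Variables (n : nat) (R : countComNzRingType).

Definition mpoly_terms (p : {mpoly R[n]}) : seq ('X_{1..n} * R) :=
  [seq (m, p@_m) | m <- msupp p].

Definition mpoly_of_terms (s : seq ('X_{1..n} * R)) : {mpoly R[n]} :=
  \sum_(t <- s) t.2 *: 'X_[t.1].

Lemma mpoly_termsK : cancel mpoly_terms mpoly_of_terms.
Proof. by move=> p; rewrite /mpoly_of_terms big_map -mpolyE. Qed.

HB.instance Definition _ := CanIsCountable mpoly_termsK.

End CountableMpoly.

Section Rabinowitsch.

Variables (R : comNzRingType) (S : idealr R) (g : R).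
Implicit Types (a b p : {poly R}) (N : nat).

Definition rabinowitsch_ideal : {pred {poly R}} :=
  [pred p | classicb (exists b, p - b * (1 - g *: 'X) \is a polyOver S)].

Lemma rabinowitsch_idealP p :
  reflect (exists b, p - b * (1 - g *: 'X) \is a polyOver S)
    (p \in rabinowitsch_ideal).
Proof. by rewrite inE; apply: classicP. Qed.

Lemma polyOver_idealMr a p : p \is a polyOver S -> a * p \is a polyOver S.
Proof.
move/polyOverP => Sp; apply/polyOverP => i; rewrite coefM.
apply: rpred_sum => j _.
exact: idealMr.
Qed.

(* The value of g^N p at 1/g, for p of degree at most N. *)
Definition reciprocal_value N p : R := \sum_(0 <= e < N.+1) p`_e * g ^+ (N - e).

Lemma reciprocal_value1 N : reciprocal_value N 1 = g ^+ N.
Proof.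
rewrite /reciprocal_value big_nat_recl // coef1 mul1r subn0.
rewrite big1_seq ?addr0 // => e _.
by rewrite coef1 mul0r.
Qed.

Lemma reciprocal_valueB N p1 p2 :
  reciprocal_value N (p1 - p2) = reciprocal_value N p1 - reciprocal_value N p2.
Proof. by rewrite -sumrB; apply: eq_bigr => e _; rewrite coefB mulrBl. Qed.

Lemma reciprocal_value_root N b :
  (size b <= N)%N -> reciprocal_value N (b * (1 - g *: 'X)) = 0.
Proof.
move=> le_N; pose shift e := (b * 'X)`_e * g ^+ (N.+1 - e).
rewrite /reciprocal_value
  (eq_big_nat _ _ (F2 := fun e => shift e.+1 - shift e)).
  rewrite telescope_sumr // /shift !coefMX /= nth_default ?mul0r ?subrr //.
move=> e /andP[_ lt_e].
rewrite /shift subSS subSn // exprS mulrA -mulrBl !coefMX /=.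
by rewrite mulrBr mulr1 -scalerAr coefB coefZ coefMX [g * _]mulrC.
Qed.

Lemma reciprocal_value_polyOver N p :
  p \is a polyOver S -> reciprocal_value N p \in S.
Proof.
move/polyOverP => Sp; apply: rpred_sum => e _.
by rewrite mulrC; apply: idealMr.
Qed.

Lemma idealr_closed_rabinowitsch :
  (forall N, g ^+ N \notin S) -> idealr_closed rabinowitsch_ideal.
Proof.
move=> gS; split.
- by apply/rabinowitsch_idealP; exists 0; rewrite mul0r subr0 rpred0.
- apply/rabinowitsch_idealP => -[b /(reciprocal_value_polyOver (size b))].
  rewrite reciprocal_valueB reciprocal_value1 reciprocal_value_root // subr0.
  by rewrite (negPf (gS _)).
- move=> a p1 p2 /rabinowitsch_idealP[b1 Sp1] /rabinowitsch_idealP[b2 Sp2].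
  apply/rabinowitsch_idealP; exists (a * b1 + b2).
  rewrite mulrDl opprD addrACA -mulrA -mulrBr.
  by apply: rpredD => //; apply: polyOver_idealMr.
Qed.

End Rabinowitsch.

Theorem ideal_avoiding_point (R : countComNzRingType) (S : idealr R) (g : R) :
  (forall N, g ^+ N \notin S) ->
  exists (L : closedFieldType) (phi : {rmorphism R -> L}),
    {in S, forall x, phi x = 0} /\ phi g != 0.
Proof.
move=> gS; have [L [phi phi0]] :=
  proper_ideal_closed_point (idealr_closed_rabinowitsch gS).
exists L, (phi \o polyC); split=> [x Sx|] /=.
  by apply: phi0; apply/rabinowitsch_idealP; exists 0;
    rewrite mul0r subr0 polyOverC.
have /phi0/eqP : 1 - g *: 'X \in rabinowitsch_ideal S g.
  by apply/rabinowitsch_idealP; exists 1; rewrite mul1r subrr rpred0.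
rewrite rmorphB rmorph1 -mul_polyC rmorphM subr_eq0; apply: contraTneq => /= ->.
by rewrite mul0r oner_eq0.
Qed.

Lemma rmorph_mpolyE (K L : comNzRingType) n
    (phi : {rmorphism {mpoly K[n]} -> L}) p :
  (map_mpoly (phi \o (@mpolyC n K)) p).@[fun i => phi 'X_i] = phi p.
Proof.
rewrite [p in RHS]mpolyE /map_mpoly /mmap !raddf_sum /=; apply: eq_bigr => m _.
rewrite mmap1_id mevalM mevalC mevalX -mul_mpolyC rmorphM /=; congr (_ * _).
rewrite [in RHS]mpolyXE_id rmorph_prod; apply: eq_bigr => i _.
by rewrite rmorphXn.
Qed.

Theorem nullstellensatz (K : countComNzRingType) n (I : finType)
    (f : I -> {mpoly K[n]}) (g : {mpoly K[n]}) :
  (forall (L : closedFieldType) (iota : {rmorphism K -> L}) (x : 'I_n -> L),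
     (forall l, (map_mpoly iota (f l)).@[x] = 0) ->
     (map_mpoly iota g).@[x] = 0) ->
  exists N, ideal_of f (g ^+ N).
Proof.
move=> g_zero; have [//|no_power] := classicP (exists N, ideal_of f (g ^+ N)).
pose S : {pred {mpoly K[n]}} := fun x => classicb (ideal_of f x).
have SP x : reflect (ideal_of f x) (x \in S).
  by rewrite unfold_in; apply: classicP.
have gS N : g ^+ N \notin S by apply/SP => in_f; apply: no_power; exists N.
have idealS : idealr_closed S.
  split=> [||a x y /SP fx /SP fy]; [exact/SP/ideal_of0|exact: (gS 0)|].
  exact/SP/ideal_ofD/fy/ideal_ofM.
pose J : idealr {mpoly K[n]} := HB.pack S (isIdealr.Build _ S idealS).
have [L [phi [phi0 /eqP[]]]] := @ideal_avoiding_point _ J g gS.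
rewrite -rmorph_mpolyE; apply: g_zero => l; rewrite rmorph_mpolyE.
exact/phi0/SP/mem_ideal_of.
Qed.

(** * Matrices acting on families *)

Definition mxcomb (R : nzRingType) (V : lmodType R) m n
    (A : 'M[R]_(m, n)) (y : 'I_n -> V) (i : 'I_m) : V :=
  \sum_l A i l *: y l.

Section MatrixCombinations.

Variables (R : nzRingType) (V : lmodType R).

Lemma eq_mxcomb m n (A : 'M[R]_(m, n)) (y z : 'I_n -> V) :
  y =1 z -> mxcomb A y =1 mxcomb A z.
Proof. by move=> eq_yz i; apply: eq_bigr => l _; rewrite eq_yz. Qed.

Lemma mxcomb0 m n (y : 'I_n -> V) (i : 'I_m) : mxcomb 0 y i = 0.
Proof. by rewrite /mxcomb big1 // => l _; rewrite mxE scale0r. Qed.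

Lemma mxcomb1 n (y : 'I_n -> V) : mxcomb 1%:M y =1 y.
Proof.
move=> i; rewrite /mxcomb (big_only1 i) ?mxE ?eqxx ?scale1r // => l /negPf ne _.
by rewrite mxE eq_sym ne scale0r.
Qed.

Lemma mxcomb_delta m n (i : 'I_m) k (y : 'I_n -> V) :
  mxcomb (delta_mx i k) y i = y k.
Proof.
rewrite /mxcomb (big_only1 k) ?mxE ?eqxx ?scale1r // => l /negPf ne _.
by rewrite mxE ne andbF scale0r.
Qed.

Lemma mxcombM m n k (A : 'M[R]_(m, n)) (B : 'M[R]_(n, k)) (y : 'I_k -> V) :
  mxcomb (A *m B) y =1 mxcomb A (mxcomb B y).
Proof.
move=> i; rewrite /mxcomb; under [RHS]eq_bigr do rewrite scaler_sumr.
rewrite exchange_big; apply: eq_bigr => l _; rewrite mxE scaler_suml.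
by apply: eq_bigr => j _; rewrite scalerA.
Qed.

Lemma mxcombB m n (A : 'M[R]_(m, n)) (y z : 'I_n -> V) i :
  mxcomb A (fun l => y l - z l) i = mxcomb A y i - mxcomb A z i.
Proof. by rewrite -sumrB; apply: eq_bigr => l _; rewrite scalerBr. Qed.

Lemma linear_mxcomb (W : lmodType R) (phi : {linear V -> W}) m n
    (A : 'M[R]_(m, n)) (y : 'I_n -> V) i :
  phi (mxcomb A y i) = mxcomb A (phi \o y) i.
Proof. by rewrite linear_sum; apply: eq_bigr => l _; rewrite linearZ. Qed.

End MatrixCombinations.

Lemma mxcomb_invmx (R : comUnitRingType) (V : lmodType R) n (A : 'M[R]_n)
    (x y : 'I_n -> V) :
  A \in unitmx -> x =1 mxcomb A y -> y =1 mxcomb (invmx A) x.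
Proof.
by move=> unitA xE i; rewrite (eq_mxcomb _ xE) -mxcombM mulVmx // mxcomb1.
Qed.

Section DualMonomials.

Variables (R : nzRingType) (n : nat) (I : finType).
Variables (x : I -> {mpoly R[n]}) (mon : I -> 'X_{1..n}).

Definition dual_monomials : Prop := forall i k, (x i)@_(mon k) = (i == k)%:R.

Lemma mcoeff_sum_dual (v : I -> R) k :
  dual_monomials -> (\sum_i v i *: x i)@_(mon k) = v k.
Proof.
move=> dual_x; rewrite raddf_sum (big_only1 k) //= ?mcoeffZ ?dual_x ?eqxx
  ?mulr1 //.
by move=> i /negPf ne _; rewrite mcoeffZ dual_x ne mulr0.
Qed.

End DualMonomials.

Lemma dual_row_free (K : fieldType) n m k (x : 'I_m -> {mpoly K[n]})
    (mon : 'I_m -> 'X_{1..n}) (A : 'M[K]_(m, k)) (y : 'I_k -> {mpoly K[n]}) :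
  dual_monomials x mon -> x =1 mxcomb A y -> row_free A.
Proof.
move=> dual_x xE; apply: inj_row_free => v vA; apply/rowP => i.
rewrite mxE -(mcoeff_sum_dual (v 0) i dual_x) -/(mxcomb v x 0).
by rewrite (eq_mxcomb _ xE) -mxcombM vA mxcomb0 mcoeff0.
Qed.

Section BilinearExpressions.

Variables (R : comNzRingType) (T : comAlgType R).

Definition mxform m n (B : 'M[R]_(m, n)) (x : 'I_m -> T) (y : 'I_n -> T) : T :=
  \sum_i x i * mxcomb B y i.

Lemma mxformE m n (B : 'M[R]_(m, n)) (x : 'I_m -> T) (y : 'I_n -> T) :
  mxform B x y = \sum_i \sum_j B i j *: (x i * y j).
Proof.
apply: eq_bigr => i _; rewrite mulr_sumr; apply: eq_bigr => j _.
by rewrite scalerAr.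
Qed.

Lemma mxcomb_mull m n (A : 'M[R]_(m, n)) h (y : 'I_n -> T) i :
  mxcomb A (fun j => h * y j) i = h * mxcomb A y i.
Proof. by rewrite mulr_sumr; apply: eq_bigr => j _; rewrite scalerAr. Qed.

Lemma eq_mxforml m n (B : 'M[R]_(m, n)) (x z : 'I_m -> T) (y : 'I_n -> T) :
  x =1 z -> mxform B x y = mxform B z y.
Proof. by move=> eq_xz; apply: eq_bigr => i _; rewrite eq_xz. Qed.

Lemma mxform_tr m n (B : 'M[R]_(m, n)) (x : 'I_m -> T) (y : 'I_n -> T) :
  mxform B^T y x = mxform B x y.
Proof.
rewrite !mxformE exchange_big; apply: eq_bigr => i _; apply: eq_bigr => j _.
by rewrite mxE mulrC.
Qed.

Lemma mxformBr m n (B : 'M[R]_(m, n)) (x : 'I_m -> T) (y z : 'I_n -> T) h :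
  mxform B x (fun j => y j - h * z j) = mxform B x y - h * mxform B x z.
Proof.
rewrite /mxform mulr_sumr -sumrB; apply: eq_bigr => i _.
by rewrite mxcombB mxcomb_mull mulrBr mulrCA.
Qed.

Lemma mxform_delta m n (B : 'M[R]_(m, n)) k (y : 'I_n -> T) :
  mxform B (fun i => (i == k)%:R) y = mxcomb B y k.
Proof.
rewrite /mxform (big_only1 k) ?eqxx ?mul1r // => i /negPf -> _.
by rewrite mul0r.
Qed.

End BilinearExpressions.

(** * Alternating matrices *)

Lemma mx_neq0_of_det (R : comNzRingType) n (B : 'M[R]_n) :
  (0 < n)%N -> \det B != 0 -> B != 0.
Proof. by case: n B => // n B _; apply: contraNneq => ->; rewrite det0. Qed.

Section AlternatingMatrices.

Variable K : fieldType.

Lemma skew_zero_diagE m (A : 'M[K]_m) i j : skew_zero_diag A -> A i j = - A j i.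
Proof. by move=> [/matrixP/(_ j i)]; rewrite !mxE. Qed.

Lemma mxform_skew (T : comAlgType K) m (A : 'M[K]_m) (x : 'I_m -> T) :
  skew_zero_diag A -> mxform A x x = 0.
Proof.
move=> skewA; rewrite mxformE; apply: sum_alternating => [i|i j].
  by rewrite (proj2 skewA) scale0r.
by rewrite (skew_zero_diagE i j skewA) scaleNr mulrC.
Qed.

Lemma skew_zero_diag_mxsub m k (A : 'M[K]_m) (h : 'I_k -> 'I_m) :
  skew_zero_diag A -> skew_zero_diag (mxsub h h A).
Proof.
move=> skewA; split=> [|i]; last by rewrite mxE (proj2 skewA).
by apply/matrixP => i j; rewrite !mxE; apply: skew_zero_diagE.
Qed.

Lemma skew_zero_diag_congr m k (A : 'M[K]_m) (P : 'M[K]_(k, m)) :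
  skew_zero_diag A -> skew_zero_diag (P *m A *m P^T).
Proof.
move=> skewA; have [trA A0] := skewA; split=> [|i].
  by rewrite !trmx_mul trmxK trA mulNmx mulmxN mulmxA.
rewrite mxE; under eq_bigr do rewrite !mxE mulr_suml.
apply: sum_alternating => [j|j l]; first by rewrite A0 mulr0 mul0r.
by rewrite (skew_zero_diagE l j skewA) mulrN mulNr mulrC mulrA mulrAC.
Qed.

Lemma skew_zero_diagN m (A : 'M[K]_m) :
  skew_zero_diag A -> skew_zero_diag (- A).
Proof.
by move=> [trA A0]; split=> [|i]; rewrite ?raddfN /= ?trA // mxE A0 oppr0.
Qed.

Lemma skew_zero_diag_tr m (A : 'M[K]_m) :
  skew_zero_diag A -> skew_zero_diag A^T.
Proof. by move=> skewA; rewrite (proj1 skewA); apply: skew_zero_diagN. Qed.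

Lemma skew_zero_diag_invmx m (A : 'M[K]_m) :
  A \in unitmx -> skew_zero_diag A -> skew_zero_diag (invmx A).
Proof.
move=> unitA skewA.
have -> : invmx A = (invmx A *m A^T *m (invmx A)^T).
  by rewrite trmx_inv -mulmxA mulmxV ?unitmx_tr // mulmx1.
exact/skew_zero_diag_congr/skew_zero_diag_tr.
Qed.

(* In characteristic 2 the sign argument says nothing, so A is specialised
   from the generic alternating matrix over the integers. *)
Lemma det_skew_zero_diag_odd m (A : 'M[K]_m) :
  skew_zero_diag A -> odd m -> \det A = 0.
Proof.
move=> skewA odd_m.
pose U : 'M[{mpoly int[m * m]}]_m :=
  \matrix_(i, j) (if (i < j)%N then 'X_(mxvec_index i j) else 0).
have det_generic : \det (U - U^T) = 0.
  have /eqP : \det (U - U^T) = - \det (U - U^T).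
    rewrite -[LHS]det_tr raddfB /= trmxK -opprB -scaleN1r detZ.
    by rewrite -signr_odd odd_m mulN1r.
  rewrite -subr_eq0 opprK -mulr2n -scaler_nat mscalerI.
  by case/orP => /eqP.
pose phi : {rmorphism {mpoly int[m * m]} -> K} := mmap intr (mxvec A 0).
have phiX i j : phi 'X_(mxvec_index i j) = A i j.
  by rewrite /phi /= mmapX mmap1U mxvecE.
have -> : A = map_mx phi (U - U^T).
  apply/matrixP => i j; rewrite !mxE rmorphB /=.
  case: (ltngtP i j) => [lt|lt|/val_inj ->];
    rewrite ?phiX ?rmorph0 ?subr0 ?sub0r ?(proj2 skewA) //.
  by rewrite -skew_zero_diagE.
by rewrite det_map_mx det_generic rmorph0.
Qed.

Lemma exists_unitmx_delta m (v : 'rV[K]_m.+1) : v != 0 ->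
  exists2 M : 'M[K]_m.+1, M \in unitmx & v *m M = delta_mx 0 0.
Proof.
move=> v_neq0; have := mulmx_ebase v; rewrite (rank_rV v) v_neq0.
move: (col_ebase_unit v) (row_ebase_unit v).
move: (col_ebase v) (row_ebase v) => a U unit_a unitU <-.
have a_neq0 : a 0 0 != 0.
  by move: unit_a; rewrite unitmxE [a]mx11_scalar det_scalar1 unitfE mxE.
exists ((a 0 0)^-1 *: invmx U);
  first by rewrite unitmxZ ?unitfE ?invr_eq0 ?unitmx_inv.
rewrite -scalemxAr mulmxK // [a]mx11_scalar mul_scalar_mx scalerA !mxE eqxx
  mulVf //.
by rewrite scale1r; apply/rowP => j; rewrite !mxE; case: j => [[|j] ?].
Qed.

End AlternatingMatrices.

(** * Derivatives of polynomials *)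

Lemma mpolyX_neq0 (R : nzRingType) n (m : 'X_{1..n}) : 'X_[R, m] != 0.
Proof. by rewrite -msupp_eq0 msuppX. Qed.

Lemma mpoly_ring_ind (R : nzRingType) n (P : {mpoly R[n]} -> Prop) :
  (forall c, P c%:MP) -> (forall i, P 'X_i) ->
  (forall F G, P F -> P G -> P (F + G)) ->
  (forall F G, P F -> P G -> P (F * G)) ->
  forall F, P F.
Proof.
move=> PC PX PD PM F; rewrite [F]mpolyE.
have P0 : P 0 by rewrite -mpolyC0.
have P1 : P 1 by rewrite -mpolyC1.
apply: (big_ind P) => // m _; rewrite -mul_mpolyC; apply: (PM _ _ (PC _)).
rewrite mpolyXE_id; apply: (big_ind P) => // i _.
by elim: (m i) => // k IHk; rewrite exprS; apply: PM.
Qed.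

Section Derivatives.

Variables (R : comNzRingType) (n : nat).
Implicit Types (F : {mpoly R[n]}) (m : 'X_{1..n}).

Lemma mderivXU i j : ('X_i : {mpoly R[n]})^`M(j) = (i == j)%:R.
Proof.
rewrite mderivX mnm1E; case: eqP => [->|_]; last by rewrite scale0r.
by have := addmK U_(j)%MM 0%MM; rewrite add0m scale1r => ->; rewrite mpolyX0.
Qed.

Lemma mulX_mderivX i m : 'X_i * ('X_[m])^`M(i) = (m i)%:R *: 'X_[R, m].
Proof.
rewrite mderivX -scalerAr; case: (posnP (m i)) => [->|mi_gt0];
  first by rewrite !scale0r.
by rewrite -mpolyXD addmC submK // lep1mP -lt0n.
Qed.

Lemma euler_homog d F : F \is d.-homog -> \sum_i 'X_i * F^`M(i) = d%:R *: F.
Proof.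
move=> homF; rewrite [F in RHS]mpolyE scaler_sumr.
have derivE i : F^`M(i) = \sum_(m <- msupp F) F@_m *: 'X_[m]^`M(i).
  by rewrite {1}(mpolyE F) raddf_sum; apply: eq_bigr => m _; apply: mderivZ.
under eq_bigr do rewrite derivE mulr_sumr.
rewrite exchange_big /= big_seq [RHS]big_seq; apply: eq_bigr => m m_in.
rewrite -(dhomog_mf homF m_in) /= mdegE natr_sum scaler_suml.
apply: eq_bigr => i _.
by rewrite -scalerAr mulX_mderivX !scalerA mulrC.
Qed.

Lemma dhomog_mderiv d i F : F \is d.-homog -> F^`M(i) \is d.-1.-homog.
Proof.
move=> homF; apply/dhomogP => m; rewrite mcoeff_msupp mcoeff_deriv => Fm.
have : (m + U_(i))%MM \in msupp F.
  by rewrite mcoeff_msupp; apply: contraNneq Fm => ->; rewrite mul0rn.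
by move/(dhomog_mf homF) <-; rewrite /= mdegD mdeg1 addn1.
Qed.

End Derivatives.

Lemma mderiv_comp_mpoly (R : comNzRingType) n k (F : {mpoly R[k]})
    (lq : k.-tuple {mpoly R[n]}) j :
  (F \mPo lq)^`M(j) = \sum_i (F^`M(i) \mPo lq) * (tnth lq i)^`M(j).
Proof.
elim/mpoly_ring_ind: F => [c|i|F G IHF IHG|F G IHF IHG].
- rewrite comp_mpolyC mderivC big1 // => i _.
  by rewrite mderivC comp_mpoly0 mul0r.
- rewrite comp_mpolyXU -tnth_nth (big_only1 i) // => [|l /negPf ne _];
    rewrite mderivXU.
    by rewrite eqxx comp_mpoly1 mul1r.
  by rewrite eq_sym ne comp_mpoly0 mul0r.
- rewrite comp_mpolyD mderivD IHF IHG -big_split; apply: eq_bigr => i _.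
  by rewrite mderivD comp_mpolyD mulrDl.
- rewrite rmorphM mderivM IHF IHG mulr_suml mulr_sumr -big_split.
  apply: eq_bigr => i _.
  by rewrite mderivM rmorphD !rmorphM /= mulrDl mulrAC mulrA.
Qed.

(** * Homogeneous components *)

Section HomogeneousComponents.

Variables (R : comNzRingType) (n : nat).
Implicit Types F G : {mpoly R[n]}.

Lemma dhomogXU i : 'X_i \is [in R[n], 1.-homog].
Proof. by rewrite dhomogX /= mdeg1. Qed.

Lemma dhomogXUn i k : 'X_i ^+ k \is [in R[n], k.-homog].
Proof. by rewrite mpolyXn dhomogX /= mdegMn mdeg1 mul1n. Qed.

Lemma dhomog_comp_mpoly k d e (F : {mpoly R[k]}) (lq : k.-tuple {mpoly R[n]}) :
  (forall i, tnth lq i \is e.-homog) -> F \is d.-homog ->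
  F \mPo lq \is (e * d).-homog.
Proof.
move=> hom_lq homF; rewrite comp_mpolyEX big_seq; apply: rpred_sum => m m_in.
rewrite comp_mpolyX -(dhomog_mf homF m_in) /= mdegE big_distrr /=.
apply: rpredZ.
elim/big_rec2: _ => [|i G deg _ homG]; first exact: dhomog1.
by apply: dhomogM homG; apply: dhomogMn.
Qed.

Lemma pihomogM_dhomog r k F G : G \is k.-homog ->
  pihomog mdeg r (F * G) = if (r < k)%N then 0 else pihomog mdeg (r - k) F * G.
Proof.
move=> homG.
have monomialE m : pihomog mdeg r ('X_[m] * G)
    = if (r < k)%N then 0 else pihomog mdeg (r - k) 'X_[m] * G.
  have homXG : 'X_[m] * G \is (mdeg m + k).-homog by rewrite dhomogM // dhomogX.
  rewrite pihomogX; case: (eqVneq (mdeg m + k)%N r) => [def_r|ne].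
    by rewrite -def_r ltnNge leq_addl addnK eqxx /= pihomog_dE // def_r.
  rewrite (pihomog_ne0 ne homXG); case: ltnP => // le_k.
  by case: eqP => [def_m|]; rewrite ?mul0r // def_m subnK ?eqxx in ne *.
rewrite [F]mpolyE mulr_suml !raddf_sum /=.
under eq_bigr do rewrite -scalerAl linearZ /= monomialE.
case: ifP => _; first by rewrite big1 // => m _; rewrite scaler0.
rewrite mulr_suml; apply: eq_bigr => m _; by rewrite linearZ /= -scalerAl.
Qed.

Lemma pihomog0E F : pihomog mdeg 0 F = (F@_0)%:MP.
Proof.
rewrite [F in LHS]mpolyE raddf_sum /=.
under eq_bigr do rewrite linearZ /= pihomogX mdeg_eq0.
case: (boolP (0%MM \in msupp F)) => [in_supp|/memN_msupp_eq0 F0].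
  rewrite (bigD1_seq 0%MM) ?msupp_uniq //= eqxx big1 ?addr0 => [|m /negPf ->].
    by rewrite mpolyX0 -mul_mpolyC mulr1.
  by rewrite scaler0.
rewrite F0 mpolyC0 big1 // => m _; case: eqP => [->|_]; last by rewrite scaler0.
by rewrite F0 scale0r.
Qed.

Lemma homogeneous_combination (I : finType) (f a : I -> {mpoly R[n]})
    (deg : I -> nat) r G :
  G \is r.-homog -> (forall l, f l \is (deg l).-homog) ->
  (forall l, r <= deg l)%N -> G = \sum_l a l * f l ->
  G = \sum_(l | deg l == r) (a l)@_0 *: f l.
Proof.
move=> homG hom_f le_r GE; rewrite -(pihomog_dE homG) GE.
rewrite raddf_sum [RHS]big_mkcond.
apply: eq_bigr => l _ /=; rewrite (pihomogM_dhomog _ _ (hom_f l)).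
by case: ltngtP (le_r l) => // <- _; rewrite subnn pihomog0E mul_mpolyC.
Qed.

End HomogeneousComponents.

(** * Linear substitutions *)

Section LinearSubstitution.

Variables (K : fieldType) (n : nat).
Implicit Types (F : {mpoly K[n]}) (M : 'M[K]_n).

HB.instance Definition _ M :=
  GRing.LRMorphism.copy (@lin_subst K n M)
    (comp_mpoly [tuple \sum_(j < n) (M i j)%:MP * 'X_j | i < n]).

Lemma lin_substX M i : lin_subst M 'X_i = mxcomb M (fun j => 'X_j) i.
Proof.
rewrite /lin_subst comp_mpolyXU -tnth_nth tnth_mktuple.
by apply: eq_bigr => j _; rewrite mul_mpolyC.
Qed.

Lemma lin_substC M c : lin_subst M c%:MP = c%:MP.
Proof. exact: comp_mpolyC. Qed.

Lemma lin_subst_mxcombX M m (A : 'M[K]_(m, n)) i :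
  lin_subst M (mxcomb A (fun j => 'X_j) i) = mxcomb (A *m M) (fun j => 'X_j) i.
Proof.
by rewrite linear_mxcomb mxcombM; apply: eq_mxcomb => j; apply: lin_substX.
Qed.

Lemma lin_substK M : M \in unitmx -> cancel (lin_subst M) (lin_subst (invmx M)).
Proof.
move=> unitM F; elim/mpoly_ring_ind: F => [c|i|F G IHF IHG|F G IHF IHG].
- by rewrite !lin_substC.
- by rewrite lin_substX lin_subst_mxcombX mulmxV // mxcomb1.
- by rewrite !rmorphD /= IHF IHG.
- by rewrite !rmorphM /= IHF IHG.
Qed.

Lemma dhomog_lin_subst d M F : F \is d.-homog -> lin_subst M F \is d.-homog.
Proof.
rewrite -[X in _ -> _ \is X.-homog]mul1n; apply: dhomog_comp_mpoly => i.
rewrite tnth_mktuple; apply: rpred_sum => j _; rewrite mul_mpolyC.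
exact/rpredZ/dhomogXU.
Qed.

Lemma mderiv_lin_subst M F j :
  (lin_subst M F)^`M(j) = \sum_i M i j *: lin_subst M F^`M(i).
Proof.
rewrite mderiv_comp_mpoly; apply: eq_bigr => i _.
rewrite -mul_mpolyC [LHS]mulrC; congr (_ * _).
rewrite tnth_mktuple raddf_sum (big_only1 j) //= => [|l /negPf ne _].
  by rewrite mderiv_mulC mderivXU eqxx mulr1.
by rewrite mderiv_mulC mderivXU ne mulr0.
Qed.

Lemma meval_lin_subst (L : fieldType) (iota : {rmorphism K -> L}) M F
    (x : 'I_n -> L) :
  (map_mpoly iota (lin_subst M F)).@[x]
  = (map_mpoly iota F).@[fun i => \sum_j iota (M i j) * x j].
Proof.
elim/mpoly_ring_ind: F => [c|i|F G IHF IHG|F G IHF IHG].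
- by rewrite lin_substC map_mpolyC !mevalC.
- rewrite lin_substX map_mpolyX mevalXU.
  rewrite (raddf_sum (map_mpoly iota)) raddf_sum /=.
  by apply: eq_bigr => j _; rewrite map_mpolyZ map_mpolyX mevalZ mevalXU.
- by rewrite !rmorphD /= IHF IHG.
- by rewrite !rmorphM /= IHF IHG.
Qed.

Lemma smooth_lin_subst M F :
  M \in unitmx -> smooth_hypersurface F -> smooth_hypersurface (lin_subst M F).
Proof.
move=> unitM smoothF L iota x [i x_neq0] [Fx dFx].
have unitMiota : map_mx iota M \in unitmx by rewrite map_unitmx.
pose y i := \sum_j iota (M i j) * x j.
have y_mul : \col_i y i = map_mx iota M *m \col_i x i.
  by apply/colP => k; rewrite !mxE; apply: eq_bigr => j _; rewrite !mxE.
apply: (smoothF L iota y).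
  apply/existsP; apply: contraNT x_neq0; rewrite negb_exists => /forallP y0.
  have : map_mx iota M *m \col_i x i = 0.
    by rewrite -y_mul; apply/colP => k; rewrite !mxE; apply/eqP;
      rewrite -[_ == _]negbK y0.
  move/(congr1 (mulmx (invmx (map_mx iota M)))); rewrite mulKmx // mulmx0.
  by move/colP/(_ i); rewrite !mxE => ->.
split; first by rewrite -meval_lin_subst.
pose dF := \row_i (map_mpoly iota F^`M(i)).@[y].
have : dF *m map_mx iota M = 0.
  apply/rowP => j; rewrite !mxE -[RHS](dFx j) mderiv_lin_subst.
  rewrite (raddf_sum (map_mpoly iota)) raddf_sum /=; apply: eq_bigr => k _.
  by rewrite !mxE map_mpolyZ mevalZ meval_lin_subst mulrC.
move/(congr1 (mulmxr (invmx (map_mx iota M)))); rewrite /= mulmxK // mul0mx.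
by move=> /rowP dF0 k; have := dF0 k; rewrite !mxE.
Qed.

End LinearSubstitution.

(** * Syzygies of the partial derivatives *)

Lemma sum_option (V : nmodType) (I : finType) (g : option I -> V) :
  \sum_l g l = g None + \sum_i g (Some i).
Proof.
rewrite (bigD1 None) //= (reindex_omap Some id) => [|[]//]; congr (_ + _).
by apply: eq_bigl => i; rewrite /= eqxx.
Qed.

Local Notation grad F := (fun l => F^`M(l)).

Section JacobianIdeal.

Variables (K : countFieldType) (n : nat).
Implicit Types F : {mpoly K[n]}.

Definition jacobian_gen F (l : option 'I_n) : {mpoly K[n]} :=
  if l is Some i then F^`M(i) else F.

Lemma dhomog_jacobian_gen d F l :
  F \is d.-homog -> jacobian_gen F l \is (if l then d.-1 else d).-homog.
Proof. by case: l => //= i; apply: dhomog_mderiv. Qed.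

Lemma smooth_jacobian_power F : smooth_hypersurface F ->
  exists M, forall i, ideal_of (jacobian_gen F) ('X_i ^+ M).
Proof.
move=> smoothF; have power i : exists N, ideal_of (jacobian_gen F) ('X_i ^+ N).
  apply: nullstellensatz => L iota x zero_x; rewrite map_mpolyX mevalXU.
  case: (eqVneq (x i) 0) => // xi_neq0; case: (smoothF L iota x);
    first by exists i.
  by split=> [|j]; [exact: (zero_x None)|exact: (zero_x (Some j))].
have [N XN] := fin_all_exists power; exists (\sum_i N i)%N => i.
by rewrite (bigD1 i) //= addnC exprD; apply: ideal_ofM.
Qed.

Lemma smooth_grad_power d F :
  F \is d.-homog -> smooth_hypersurface F -> d%:R != 0 :> K ->
  exists M, forall i, ideal_of (grad F) ('X_i ^+ M).
Proof.
move=> homF smoothF d_neq0; have [M XM] := smooth_jacobian_power smoothF.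
exists M => i; apply: ideal_of_trans (XM i) => -[l|]; first exact: mem_ideal_of.
exists (fun l => d%:R^-1 *: 'X_l) => /=; under eq_bigr do rewrite -scalerAl.
by rewrite -scaler_sumr (euler_homog homF) scalerA mulVf // scale1r.
Qed.

Lemma smooth_grad_syzygy d r F (c : 'I_n -> {mpoly K[n]}) :
  F \is d.-homog -> smooth_hypersurface F -> d%:R != 0 :> K ->
  (forall i, c i \is r.-homog) -> (r <= d.-1)%N -> \sum_i c i * F^`M(i) = 0 ->
  exists2 A : 'M[K]_n, skew_zero_diag A &
    forall i, c i = \sum_(l | d.-1 == r) A i l *: F^`M(l).
Proof.
move=> homF smoothF d_neq0 hom_c le_r closed_c.
have [M XM] := smooth_grad_power homF smoothF d_neq0.
have [||v alt_v c_v] := koszul_mpoly_exact (d := 1) XM _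
  (alternating_fun_seq1 c).
- by rewrite card_ord add1n.
- case=> // _; rewrite -[RHS]closed_c; apply: eq_bigr => i _ /=.
  by rewrite mulrC.
exists (\matrix_(i, l) (v [:: l; i])@_0).
  split=> [|i]; last by rewrite mxE (alt_v.1 [::] [::]) mcoeff0.
  by apply/matrixP => i j; rewrite !mxE (alt_v.2 [::]) mcoeffN.
move=> i; rewrite [LHS](homogeneous_combination (f := grad F) (hom_c i)
  (fun l => dhomog_mderiv l homF) _ (a := fun l => v [:: l; i])) //.
  by apply: eq_bigr => l _; rewrite mxE.
rewrite -[c i]/(fun_seq1 c [:: i]) c_v // /koszul.
by apply: eq_bigr => l _; rewrite mulrC.
Qed.

Lemma smooth_grad_free d F (v : 'rV[K]_n) :
  F \is d.-homog -> smooth_hypersurface F -> d%:R != 0 :> K -> (1 < d)%N ->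
  mxcomb v (grad F) 0 = 0 -> v = 0.
Proof.
move=> homF smoothF d_neq0 lt1d vF0.
have [|||A _ vA] := smooth_grad_syzygy (r := 0) (c := fun i => (v 0 i)%:MP)
  homF smoothF d_neq0.
- by move=> i; rewrite -[_%:MP]mulr1 mul_mpolyC; apply/rpredZ/dhomog1.
- by [].
- by rewrite -[RHS]vF0; apply: eq_bigr => l _; rewrite mul_mpolyC.
apply/rowP => i; rewrite mxE; apply/eqP.
rewrite -(mpolyC_eq0 n) vA big_pred0 //.
by move=> _; case: d lt1d {homF d_neq0 vA} => [|[]].
Qed.

Lemma smooth_grad_neq0 d F : (1 < n)%N -> (0 < d)%N -> F != 0 ->
  F \is d.-homog -> smooth_hypersurface F -> exists i, F^`M(i) != 0.
Proof.
move=> lt1n d_gt0 F_neq0 homF smoothF; apply/existsP; apply: contraTT d_gt0.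
rewrite negb_exists => /forallP dF0.
have [M XM] := smooth_jacobian_power smoothF.
have lead_le i : (mlead F <= U_(i) *+ M)%MM.
  have [a] := XM i; rewrite sum_option big1 ?addr0 => [/= XE|l _]; last first.
    by have := dF0 l; rewrite negbK /= => /eqP ->; rewrite mulr0.
  have a_neq0 : a None != 0.
    by apply: contraNneq (mpolyX_neq0 K (U_(i) *+ M)) => a0;
      rewrite -mpolyXn XE a0 mul0r.
  by rewrite -(mleadXm K (U_(i) *+ M)%MM) -mpolyXn XE mleadM // lem_addl.
rewrite -leqNgt leqn0 -(dhomog_mf homF (mlead_supp F_neq0)) mdeg_eq0.
apply/eqP/mnmP => j; rewrite mnm0E; apply/eqP; rewrite -leqn0.
have [i ne] : exists i : 'I_n, i != j.
  have [j0|j_gt0] := posnP j.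
    by exists (Ordinal lt1n); rewrite -val_eqE /= j0.
  by exists (Ordinal (ltnW lt1n)); rewrite -val_eqE /= neq_ltn j_gt0.
by have /mnm_lepP/(_ j) := lead_le i; rewrite mulmnE mnm1E (negPf ne).
Qed.

End JacobianIdeal.

(** * The Frobenius derivation *)

Lemma pchar_eq2 (R : nzRingType) p : p \in [pchar R] -> 2%:R = 0 :> R -> p = 2.
Proof.
move=> pcharR /eqP; rewrite -(dvdn_pcharf pcharR) => p_dvd2.
by apply/eqP; rewrite -dvdn_prime2 ?(pcharf_prime pcharR).
Qed.

Lemma mderiv_expr (R : comNzRingType) n m (G : {mpoly R[n]}) j :
  (G ^+ m)^`M(j) = m%:R *: (G ^+ m.-1 * G^`M(j)).
Proof.
elim: m => [|m IHm]; first by rewrite expr0 -mpolyC1 mderivC scale0r.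
rewrite exprS mderivM IHm -scalerAr mulrA -exprS -natr1 scalerDl scale1r.
rewrite addrC /=.
rewrite [G^`M(j) * _]mulrC; case: m {IHm} => [|m] //=.
by rewrite !scale0r.
Qed.

Lemma card_finField_gt1 (K : finFieldType) : (1 < #|K|)%N.
Proof. exact: finNzRing_gt1. Qed.

Section FrobeniusMonomials.

Variable K : finFieldType.
Local Notation q := #|K|.

Variable n : nat.
Implicit Types (F H : {mpoly K[n]}) (i j : 'I_n).

Lemma dual_frob_monomials : dual_monomials
  (fun u : 'I_n * 'I_n => 'X_u.1 ^+ q * 'X_u.2 : {mpoly K[n]})
  (fun u => U_(u.1) *+ q + U_(u.2))%MM.
Proof.
move=> [i j] [k l]; rewrite mpolyXn -mpolyXD mcoeffX; congr (nat_of_bool _)%:R.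
have q_gt1 := card_finField_gt1 K; apply/eqP/eqP => [/mnmP eq_mon|[-> ->] //].
have eq_ik : i = k.
  have := eq_mon i; rewrite !mnmDE !mulmnE !mnm1E eqxx.
  case: (eqVneq k i) => // _; move: q_gt1; move: #|K| => r.
  by case: (l == i); case: (j == i) => /=; lia.
congr (_, _) => //; have := eq_mon j; rewrite !mnmDE !mulmnE !mnm1E eq_ik eqxx.
by move=> /addnI; case: (eqVneq l j).
Qed.

Lemma frob_monomial_neq i j : i != j ->
  'X_i ^+ q * 'X_j != 'X_j ^+ q * 'X_i :> {mpoly K[n]}.
Proof.
move=> /negPf ne; apply/eqP => /(congr1 (mcoeff (U_(i) *+ q + U_(j))%MM)).
rewrite (dual_frob_monomials (i, j) (i, j)) (dual_frob_monomials (j, i) (i, j)).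
by rewrite eqxx xpair_eqE eq_sym ne => /eqP; rewrite oner_eq0.
Qed.

Lemma frob_formE (A : 'M[K]_n) :
  frob_form q A = mxform A^T (fun j => 'X_j) (fun i => 'X_i ^+ q).
Proof.
rewrite mxform_tr mxformE; apply: eq_bigr => i _; apply: eq_bigr => j _.
by rewrite mulrAC mulrC mul_mpolyC.
Qed.

Lemma frob_form_tailE (B : 'M[K]_n) :
  frob_form_tail q B
  = mxform B^T (fun j => 'X_(lift ord0 j)) (fun i => 'X_(lift ord0 i) ^+ q).
Proof.
rewrite mxform_tr mxformE; apply: eq_bigr => i _; apply: eq_bigr => j _.
by rewrite mulrAC mulrC mul_mpolyC.
Qed.

Lemma dhomog_frob_form (A : 'M[K]_n) : frob_form q A \is q.+1.-homog.
Proof.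
rewrite /frob_form; apply: rpred_sum => i _; apply: rpred_sum => j _.
by rewrite mulrAC mulrC mul_mpolyC -addn1 rpredZ ?dhomogM ?dhomogXUn ?dhomogXU.
Qed.

Lemma dhomog_frob10 d F :
  (0 < d)%N -> F \is d.-homog -> frob10 q F \is (q.-1 + d)%N.-homog.
Proof.
move=> d_gt0 homF; apply: rpred_sum => i _.
have -> : (q.-1 + d = q + d.-1)%N by have := card_finField_gt1 K; lia.
by apply: dhomogM (dhomog_mderiv i homF); apply: dhomogXUn.
Qed.

Lemma frob10_quotient_dhomog d F : (0 < d)%N -> F \is d.-homog ->
  frobenius_nonclassical q F ->
  exists2 H, H \is q.-1.-homog & frob10 q F = H * F.
Proof.
move=> d_gt0 homF [H HF]; exists (pihomog mdeg q.-1 H); first exact: pihomogP.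
rewrite -(pihomog_dE (dhomog_frob10 d_gt0 homF)) HF (pihomogM_dhomog _ _ homF).
by rewrite ltnNge leq_addl addnK.
Qed.

(* In degree at most q each summand X_i^q F_i only has monomials divisible by
   X_i^q, and no monomial is divisible by two such powers. *)
Lemma frob10_eq0_grad d F : (d <= q)%N -> F \is d.-homog -> frob10 q F = 0 ->
  forall i, F^`M(i) = 0.
Proof.
move=> le_dq homF frobF0 i; apply/mpolyP => m; rewrite mcoeff0; apply/eqP.
have q_gt1 := card_finField_gt1 K; apply: contraT => Fm_neq0.
have deg_m : (mdeg m < q)%N.
  rewrite -mcoeff_msupp in Fm_neq0.
  rewrite (dhomog_mf (dhomog_mderiv i homF) Fm_neq0).
  by move: le_dq q_gt1 => /=; lia.
case/eqP: Fm_neq0; rewrite -(mcoeff0 K (m + U_(i) *+ q)%MM) -frobF0.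
rewrite [RHS]raddf_sum (big_only1 i) //= => [|j ne _].
  by rewrite mpolyXn mulrC addmC mcoeffMX.
rewrite mpolyXn mulrC mcoeff_mulX ifN //; apply: contraTN deg_m.
move=> /mnm_lepP/(_ j); rewrite mnmDE !mulmnE !mnm1E eqxx eq_sym (negPf ne).
rewrite mul1n mul0n addn0 -leqNgt => /leq_trans; apply.
by rewrite mdegE (bigD1 j) //= leq_addr.
Qed.

Lemma frob10_eq0_degree d F : (1 < n)%N -> (0 < d)%N -> F != 0 ->
  F \is d.-homog -> smooth_hypersurface F -> frob10 q F = 0 -> (q < d)%N.
Proof.
move=> lt1n d_gt0 F_neq0 homF smoothF frobF0; rewrite ltnNge.
apply/negP => le_dq.
have [i /eqP[]] := smooth_grad_neq0 lt1n d_gt0 F_neq0 homF smoothF.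
exact: frob10_eq0_grad homF frobF0 i.
Qed.

End FrobeniusMonomials.

Section FrobeniusLinearity.

Variable K : finFieldType.
Local Notation q := #|K|.

Lemma pnat_card_finField p : p \in [pchar K] -> p.-nat q.
Proof.
move=> pcharK; have /abelem_pgroup := fin_ring_pchar_abelem pcharK.
by rewrite /pgroup cardsT.
Qed.

Lemma natr_card_finField : q%:R = 0 :> K.
Proof.
have [p _ pcharK] := finPcharP K.
have [[|k] card_K] := p_natP (pnat_card_finField pcharK); apply/eqP.
  by have := card_finField_gt1 K; rewrite card_K.
by rewrite card_K -(dvdn_pcharf pcharK) dvdn_exp.
Qed.

Lemma natr_succ_card : q.+1%:R = 1 :> K.
Proof. by rewrite -natr1 natr_card_finField add0r. Qed.

Lemma natr_pred_card : q.-1%:R = -1 :> K.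
Proof.
apply/eqP; rewrite -subr_eq0 opprK natr1 prednK ?natr_card_finField //.
exact: ltnW (card_finField_gt1 K).
Qed.

Variable n : nat.
Implicit Types F G : {mpoly K[n]}.

Lemma mpoly_frobD F G : (F + G) ^+ q = F ^+ q + G ^+ q.
Proof.
have [p _ pcharK] := finPcharP K; apply: exprDn_pchar.
apply: sub_in_pnat (pnat_card_finField pcharK) => r _ /eqP -> /=.
by rewrite pchar_lalg.
Qed.

Lemma mxcomb_frob m k (A : 'M[K]_(m, k)) (x : 'I_k -> {mpoly K[n]}) i :
  mxcomb A x i ^+ q = mxcomb A (fun l => x l ^+ q) i.
Proof.
rewrite /mxcomb; elim/big_rec2: _ => [|l F G _ <-].
  by rewrite expr0n (gtn_eqF (ltnW (card_finField_gt1 K))).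
by rewrite mpoly_frobD exprZn expf_card.
Qed.

Lemma mderiv_frob G j : (G ^+ q)^`M(j) = 0.
Proof. by rewrite mderiv_expr natr_card_finField scale0r. Qed.

Lemma mderiv_mxform_frob m k (B : 'M[K]_(m, k)) (x : 'I_m -> {mpoly K[n]})
    (y : 'I_k -> {mpoly K[n]}) j :
  (mxform B x (fun i => y i ^+ q))^`M(j)
  = mxform B (fun i => (x i)^`M(j)) (fun i => y i ^+ q).
Proof.
rewrite raddf_sum; apply: eq_bigr => i _ /=; rewrite mderivM linear_mxcomb.
rewrite [X in _ + _ * X]big1 ?mulr0 ?addr0 // => l _.
by rewrite /= mderiv_frob scaler0.
Qed.

Lemma mderiv_frob_form (A : 'M[K]_n) j :
  (frob_form q A)^`M(j) = mxcomb A^T (fun i => 'X_i ^+ q) j.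
Proof.
rewrite frob_formE mderiv_mxform_frob -mxform_delta.
by apply: eq_mxforml => i; rewrite mderivXU.
Qed.

Lemma frob10_frob_form (A : 'M[K]_n) :
  skew_zero_diag A -> frob10 q (frob_form q A) = 0.
Proof.
move=> /skew_zero_diag_tr skewA.
rewrite -[RHS](mxform_skew (fun i => 'X_i ^+ q) skewA).
by apply: eq_bigr => j _; rewrite mderiv_frob_form.
Qed.

Lemma frob10_lin_subst M F :
  frob10 q (lin_subst M F) = lin_subst M (frob10 q F).
Proof.
rewrite rmorph_sum /frob10 /=.
under eq_bigr do rewrite mderiv_lin_subst mulr_sumr.
rewrite exchange_big; apply: eq_bigr => i _.
rewrite rmorphM rmorphXn /= lin_substX mxcomb_frob mulr_suml.
apply: eq_bigr => j _.
by rewrite -scalerAr scalerAl.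
Qed.

End FrobeniusLinearity.

(** * Degree q + 1 *)

Section NonclassicalSyzygy.

Variable K : finFieldType.
Local Notation q := #|K|.

Lemma nonclassical_syzygy n d (F H : {mpoly K[n]}) :
  F \is d.-homog -> smooth_hypersurface F -> d%:R != 0 :> K -> (q < d)%N ->
  H \is q.-1.-homog -> frob10 q F = H * F ->
  exists2 A : 'M[K]_n, skew_zero_diag A &
    forall i, 'X_i ^+ q - (d%:R^-1 *: H) * 'X_i
      = \sum_(l | d.-1 == q) A i l *: F^`M(l).
Proof.
move=> homF smoothF d_neq0 lt_qd homH frobF.
apply: smooth_grad_syzygy => // [i||].
- apply: rpredB; first exact: dhomogXUn.
  have -> : q = (q.-1 + 1)%N by have := card_finField_gt1 K; lia.
  by apply: dhomogM (dhomogXU _ i); apply: rpredZ.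
- by case: d lt_qd {homF d_neq0}.
under eq_bigr do rewrite mulrBl -mulrA.
rewrite sumrB -mulr_sumr (euler_homog homF) -/(frob10 q F) frobF.
by rewrite -scalerAl -scalerAr scalerA mulVf // scale1r subrr.
Qed.

Lemma nonclassical_degree_le_succ n d (F H : {mpoly K[n.+2]}) :
  F \is d.-homog -> smooth_hypersurface F -> d%:R != 0 :> K ->
  H \is q.-1.-homog -> frob10 q F = H * F -> (d <= q.+1)%N.
Proof.
move=> homF smoothF d_neq0 homH frobF; rewrite leqNgt; apply/negP => lt_qd.
have [A _ XA] :=
  nonclassical_syzygy homF smoothF d_neq0 (ltnW lt_qd) homH frobF.
have Xq i : 'X_i ^+ q = (d%:R^-1 *: H) * 'X_i.
  apply/eqP; rewrite -subr_eq0 XA big_pred0 // => _.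
  by case: d lt_qd {homF d_neq0 XA} => // d; rewrite ltnS => /gtn_eqF.
by have := @frob_monomial_neq K n.+2 0 1 isT; rewrite !Xq mulrAC eqxx.
Qed.

End NonclassicalSyzygy.

Section FrobeniusFormTail.

Variables (K : finFieldType) (n : nat).
Local Notation q := #|K|.
Local Notation X0 := ('X_ord0 : {mpoly K[n.+1]}).
Local Notation y i := ('X_(lift ord0 i) : {mpoly K[n.+1]}).
Implicit Types (B : 'M[K]_n) (G : {mpoly K[n.+1]}).

Lemma mnm_lift0E (i : 'I_n) : U_(lift ord0 i)%MM ord0 = 0%N.
Proof. by rewrite mnm1E eq_sym (negPf (neq_lift _ _)). Qed.

Lemma dual_singular_syzygy : dual_monomials
  (fun i : 'I_n => y i ^+ q - X0 ^+ q.-1 * y i)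
  (fun k => U_(lift ord0 k) *+ q)%MM.
Proof.
move=> i k; have q_gt1 := card_finField_gt1 K.
rewrite mcoeffB !mpolyXn -mpolyXD !mcoeffX.
have -> : (U_(ord0) *+ q.-1 + U_(lift ord0 i) == U_(lift ord0 k) *+ q)%MM
    = false.
  apply/eqP => /mnmP/(_ ord0).
  rewrite mnmDE !mulmnE !mnm_lift0E mnm1E eqxx mul1n.
  by rewrite mul0n addn0; lia.
rewrite subr0; congr (nat_of_bool _)%:R; apply/eqP/eqP => [/mnmP eq_mon|-> //].
have := eq_mon (lift ord0 k); rewrite !mulmnE !mnm1E eqxx (inj_eq lift_inj).
by case: eqP => // _; rewrite mul0n mul1n; lia.
Qed.

Lemma dual_mixed_monomials : dual_monomials
  (fun i : 'I_n => X0 ^+ q.-1 * y i)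
  (fun k => U_(ord0) *+ q.-1 + U_(lift ord0 k))%MM.
Proof.
move=> i k; rewrite mpolyXn -mpolyXD mcoeffX eqm_add2l.
congr (nat_of_bool _)%:R.
apply/eqP/eqP => [/mnmP/(_ (lift ord0 k))|-> //].
by rewrite !mnm1E eqxx (inj_eq lift_inj); case: eqP.
Qed.

Lemma mcoeff_frob_form_tail B k l :
  (frob_form_tail q B)@_(U_(lift ord0 k) *+ q + U_(lift ord0 l)) = B k l.
Proof.
pose x (u : 'I_n * 'I_n) : {mpoly K[n.+1]} := y u.1 ^+ q * y u.2.
pose mon (u : 'I_n * 'I_n) := (U_(lift ord0 u.1) *+ q + U_(lift ord0 u.2))%MM.
have dual_x : dual_monomials x mon.
  move=> [i j] [i' j'].
  have -> := dual_frob_monomials K (lift ord0 i, lift ord0 j)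
    (lift ord0 i', lift ord0 j').
  by rewrite !xpair_eqE !(inj_eq lift_inj).
rewrite -(mcoeff_sum_dual (fun u => B u.1 u.2) (k, l) dual_x).
rewrite frob_form_tailE mxform_tr mxformE pair_big /=.
by rewrite /x; congr mcoeff; apply: eq_bigr => -[i j].
Qed.

Lemma frob_form_tail_degree d G B : (0 < n)%N ->
  X0 * G + frob_form_tail q B \is d.-homog -> \det B != 0 -> d = q.+1.
Proof.
move=> n_gt0 homF /(mx_neq0_of_det n_gt0); apply: contraNeq => ne_d.
apply/eqP/matrixP => k l; rewrite mxE -mcoeff_frob_form_tail.
set m := (_ + _)%MM.
have := dhomog_nemf_coeff homF (m := m).
rewrite mcoeffD mulrC mcoeff_mulX ifN ?add0r.
  by apply; rewrite /= /m mdegD mdegMn !mdeg1 mul1n addn1 eq_sym.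
by rewrite lep1mP mnmDE mulmnE !mnm_lift0E.
Qed.

Lemma mderiv_frob_form_tail B k :
  (frob_form_tail q B)^`M(lift ord0 k) = mxcomb B^T (fun i => y i ^+ q) k.
Proof.
rewrite frob_form_tailE mderiv_mxform_frob -mxform_delta.
by apply: eq_mxforml => i; rewrite mderivXU (inj_eq lift_inj).
Qed.

Lemma mderiv_frob_form_tail0 B : (frob_form_tail q B)^`M(ord0) = 0.
Proof.
rewrite frob_form_tailE mderiv_mxform_frob /mxform big1 // => i _.
by rewrite mderivXU eq_sym (negPf (neq_lift _ _)) mul0r.
Qed.

End FrobeniusFormTail.

Section SingularNormalForm.

Variables (K : finFieldType) (n : nat).
Local Notation q := #|K|.
Local Notation X0 := ('X_ord0 : {mpoly K[n.+1]}).
Local Notation y i := ('X_(lift ord0 i) : {mpoly K[n.+1]}).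

Lemma degree_succ_syzygy m (F H : {mpoly K[m]}) :
  F \is q.+1.-homog -> smooth_hypersurface F -> H \is q.-1.-homog ->
  frob10 q F = H * F ->
  exists2 A : 'M[K]_m, skew_zero_diag A &
    (fun i => 'X_i ^+ q - H * 'X_i) =1 mxcomb A (grad F).
Proof.
move=> homF smoothF homH frobF; have succ_card1 := natr_succ_card K.
have [||A skewA XA] := nonclassical_syzygy homF smoothF _ _ homH frobF.
- by rewrite succ_card1 oner_eq0.
- by [].
exists A => // i; rewrite -[H]scale1r -invr1 -succ_card1 XA.
by apply: eq_bigl; rewrite eqxx.
Qed.

Variable F : {mpoly K[n.+1]}.
Hypotheses (homF : F \is q.+1.-homog) (smoothF : smooth_hypersurface F).
Hypothesis frobF : frob10 q F = X0 ^+ q.-1 * F.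

Lemma singular_grad : exists B : 'M[K]_n, [/\ skew_zero_diag B, B \in unitmx &
  forall k, F^`M(lift ord0 k)
    = mxcomb B (fun i => y i ^+ q - X0 ^+ q.-1 * y i) k].
Proof.
have q_gt1 := card_finField_gt1 K.
have [A skewA XA] := degree_succ_syzygy homF smoothF (dhomogXUn _ _ _) frobF.
have A_row0 l : A ord0 l = 0.
  have /rowP/(_ l) : row ord0 A = 0; last by rewrite !mxE.
  apply: (smooth_grad_free homF smoothF); rewrite ?natr_succ_card ?oner_eq0 //.
    exact: ltnW.
  transitivity (mxcomb A (grad F) ord0).
    by apply: eq_bigr => k _; rewrite mxE.
  by rewrite -XA -exprSr prednK ?subrr // ltnW.
pose A' := mxsub (lift ord0) (lift ord0) A.
have yA' : (fun i => y i ^+ q - X0 ^+ q.-1 * y i)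
    =1 mxcomb A' (grad F \o lift ord0).
  move=> i; rewrite XA /mxcomb big_ord_recl (skew_zero_diagE _ _ skewA) A_row0.
  by rewrite oppr0 scale0r add0r; apply: eq_bigr => j _; rewrite mxE.
have unitA' : A' \in unitmx.
  by rewrite -row_free_unit (dual_row_free (@dual_singular_syzygy K n) yA').
exists (invmx A'); split; last exact: mxcomb_invmx unitA' yA'.
  exact/skew_zero_diag_invmx/skew_zero_diag_mxsub.
by rewrite unitmx_inv.
Qed.

Variable B : 'M[K]_n.
Hypothesis skewB : skew_zero_diag B.
Hypothesis gradF : forall k,
  F^`M(lift ord0 k) = mxcomb B (fun i => y i ^+ q - X0 ^+ q.-1 * y i) k.

Lemma singular_decomposition : F = X0 * F^`M(ord0) + frob_form_tail q B^T.
Proof.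
have := euler_homog homF; rewrite natr_succ_card scale1r => {1}<-.
rewrite big_ord_recl frob_form_tailE trmxK; congr (_ + _).
under eq_bigr do rewrite gradF.
by rewrite -/(mxform B _ _) mxformBr mxform_skew // mulr0 subr0.
Qed.

Lemma singular_mderiv00 : F^`M(ord0)^`M(ord0) = 0.
Proof.
have := congr1 (mderiv ord0) singular_decomposition.
rewrite mderivD mderivM mderivXU eqxx mul1r mderiv_frob_form_tail0 addr0.
move=> /esym/eqP; rewrite -subr_eq0 addrAC subrr add0r mulf_eq0.
by rewrite (negPf (mpolyX_neq0 _ _)) => /eqP.
Qed.

Lemma mulX0_mderiv0 k :
  X0 * F^`M(lift ord0 k)^`M(ord0) = mxcomb B (fun i => X0 ^+ q.-1 * y i) k.
Proof.
have X0_deriv : X0 * (X0 ^+ q.-1)^`M(ord0) = - X0 ^+ q.-1.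
  rewrite mpolyXn mulX_mderivX mulmnE mnm1E eqxx mul1n.
  by rewrite natr_pred_card scaleN1r.
rewrite gradF linear_mxcomb -mxcomb_mull; apply: eq_mxcomb => i /=.
rewrite mderivB mderiv_frob mderivM mderivXU eq_sym (negPf (neq_lift _ _)).
by rewrite mulr0 addr0 sub0r mulrN mulrA X0_deriv mulNr opprK.
Qed.

(* F_k is known both from the syzygy and from the decomposition of F; the two
   expressions differ by twice the mixed part. *)
Lemma singular_two_eq0 : B != 0 -> 2%:R = 0 :> K.
Proof.
move=> B_neq0; apply/eqP; apply: contraNT B_neq0 => two_neq0.
apply/eqP/matrixP => k l; rewrite mxE.
set mixed := mxcomb B (fun i => X0 ^+ q.-1 * y i) k.
suff mixed0 : mixed = 0.
  rewrite -(mcoeff_sum_dual (B k) l (@dual_mixed_monomials K n))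
    -/(mxcomb B _ k).
  by rewrite -/mixed mixed0 mcoeff0.
have from_decomposition :
    F^`M(lift ord0 k) = mixed + mxcomb B (fun i => y i ^+ q) k.
  rewrite {1}singular_decomposition mderivD mderivM mderivXU mul0r add0r.
  by rewrite mderiv_comm mulX0_mderiv0 mderiv_frob_form_tail trmxK.
move: from_decomposition; rewrite gradF mxcombB addrC => /addIr/esym/eqP.
rewrite -subr_eq0 opprK -mulr2n -scaler_nat mscalerI (negPf two_neq0).
by move/eqP.
Qed.

End SingularNormalForm.

Section DegreeSucc.

Variable K : finFieldType.
Local Notation q := #|K|.

Definition skew_frobenius_form n (F : {mpoly K[n]}) : Prop :=
  exists A : 'M[K]_n, skew_zero_diag A /\ \det A != 0 /\ F = frob_form q A.

Definition singular_frobenius_form n (F : {mpoly K[n.+1]}) : Prop :=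
  exists M : 'M[K]_n.+1, M \in unitmx /\
    frob10 q (lin_subst M F) = 'X_ord0 ^+ (q - 1) * lin_subst M F /\
    exists (G : {mpoly K[n.+1]}) (B : 'M[K]_n),
      G^`M(ord0) = 0 /\ skew_zero_diag B /\ \det B != 0 /\
      lin_subst M F = 'X_ord0 * G + frob_form_tail q B.

Lemma skew_frobenius_form_of_unit n (F H : {mpoly K[n]}) (A : 'M[K]_n) :
  F \is q.+1.-homog -> skew_zero_diag A -> A \in unitmx ->
  (fun i => 'X_i ^+ q - H * 'X_i) =1 mxcomb A (grad F) -> skew_frobenius_form F.
Proof.
move=> homF skewA unitA XA; have skewB := skew_zero_diag_invmx unitA skewA.
exists (invmx A)^T; split; first exact: skew_zero_diag_tr.
split; first by rewrite det_tr -unitfE -unitmxE unitmx_inv.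
have /esym := euler_homog homF; rewrite natr_succ_card scale1r => ->.
under eq_bigr do rewrite (mxcomb_invmx unitA XA).
rewrite -/(mxform _ _ _) mxformBr mxform_skew // mulr0 subr0.
by rewrite frob_formE trmxK.
Qed.

Lemma quotient_of_singular n (F H : {mpoly K[n]}) (A : 'M[K]_n) :
  A \notin unitmx -> (fun i => 'X_i ^+ q - H * 'X_i) =1 mxcomb A (grad F) ->
  exists2 v : 'rV[K]_n, v != 0 & H = mxcomb v (fun i => 'X_i) 0 ^+ q.-1.
Proof.
rewrite -row_free_unit -kermx_eq0 => /rowV0Pn[v /sub_kermxP vA v_neq0] XA.
exists v => //; set ell := mxcomb v _ 0.
have ell_neq0 : ell != 0.
  apply: contraNneq v_neq0 => ell0; apply/eqP/rowP => k.
  have dualX : dual_monomials (fun i => 'X_i : {mpoly K[n]})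
    (fun k => U_(k)%MM).
    by move=> i j; rewrite mcoeffXU.
  rewrite mxE -(mcoeff_sum_dual (v 0) k dualX) -/(mxcomb v _ 0) -/ell.
  by rewrite ell0 mcoeff0.
apply: (mulIf ell_neq0); rewrite -exprSr prednK;
  last exact: ltnW (card_finField_gt1 K).
apply/esym/eqP; rewrite -subr_eq0 mxcomb_frob -mxcomb_mull -mxcombB.
by rewrite (eq_mxcomb _ XA) -mxcombM vA mxcomb0.
Qed.

Lemma singular_frobenius_form_of_frob10 n (F : {mpoly K[n.+1]}) : (0 < n)%N ->
  F \is q.+1.-homog -> smooth_hypersurface F ->
  frob10 q F = 'X_ord0 ^+ q.-1 * F ->
  [/\ ~~ odd n, 2%:R = 0 :> K & exists (G : {mpoly K[n.+1]}) (B : 'M[K]_n),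
    G^`M(ord0) = 0 /\ skew_zero_diag B /\ \det B != 0 /\
    F = 'X_ord0 * G + frob_form_tail q B].
Proof.
move=> n_gt0 homF smoothF frobF.
have [B [skewB unitB gradF]] := singular_grad homF smoothF frobF.
have detB : \det B != 0 by rewrite -unitfE -unitmxE.
split.
- by apply: contraNN detB => odd_n; rewrite det_skew_zero_diag_odd.
- exact/(singular_two_eq0 homF skewB gradF)/mx_neq0_of_det.
exists F^`M(ord0), B^T; split; first exact: singular_mderiv00 gradF.
split; first exact: skew_zero_diag_tr.
by rewrite det_tr; split; last exact: singular_decomposition gradF.
Qed.

Theorem degree_succ_dichotomy n (F H : {mpoly K[n.+1]}) : (0 < n)%N ->
  F \is q.+1.-homog -> smooth_hypersurface F ->
  H \is q.-1.-homog -> frob10 q F = H * F ->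
  (odd n /\ skew_frobenius_form F)
  \/ [/\ ~~ odd n, 2%:R = 0 :> K & singular_frobenius_form F].
Proof.
move=> n_gt0 homF smoothF homH frobF.
have [A skewA XA] := degree_succ_syzygy homF smoothF homH frobF.
have [unitA|singA] := boolP (A \in unitmx).
  left; split; last exact: skew_frobenius_form_of_unit XA.
  apply: contraLR unitA => even_n.
  by rewrite unitmxE det_skew_zero_diag_odd ?unitr0 //= negbK.
have [v v_neq0 def_H] := quotient_of_singular singA XA.
have [M unitM vM] := exists_unitmx_delta v_neq0.
have frobMF : frob10 q (lin_subst M F) = 'X_ord0 ^+ q.-1 * lin_subst M F.
  rewrite frob10_lin_subst frobF def_H rmorphM rmorphXn /=.
  by rewrite lin_subst_mxcombX vM mxcomb_delta.
have [] := singular_frobenius_form_of_frob10 n_gt0 (dhomog_lin_subst M homF)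
  (smooth_lin_subst unitM smoothF) frobMF.
by right; split=> //; exists M; rewrite subn1.
Qed.

End DegreeSucc.

(** * Degree q + 2 *)

Local Notation ltn_pair n := {u : 'I_n * 'I_n | (u.1 < u.2)%N}.

Lemma card_ltn_pair n : #|{: ltn_pair n}| = 'C(n, 2).
Proof.
rewrite card_sig -sum1_card -bin2_sum big_mkord.
rewrite -(pair_big_dep xpredT (fun i j : 'I_n => (i < j)%N) (fun _ _ => 1)%N).
rewrite /= (exchange_big_dep xpredT) //=; apply: eq_bigr => j _.
by rewrite (big_ord_narrow (ltnW (ltn_ord j))) sum1_card card_ord.
Qed.

Section FrobeniusMinors.

Variable K : finFieldType.
Local Notation q := #|K|.

Definition frob_minor n (i j : 'I_n) : {mpoly K[n]} :=
  'X_j ^+ q * 'X_i - 'X_i ^+ q * 'X_j.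

Lemma frob_minor_neq0 n (i j : 'I_n) : i != j -> frob_minor i j != 0.
Proof. by move=> ne; rewrite subr_eq0 frob_monomial_neq // eq_sym. Qed.

Lemma dhomog_frob_minor n (i j : 'I_n) : frob_minor i j \is q.+1.-homog.
Proof.
by rewrite -addn1; apply: rpredB; apply: dhomogM; rewrite ?dhomogXUn ?dhomogXU.
Qed.

Lemma dual_frob_minors n : dual_monomials
  (fun u : ltn_pair n => frob_minor (val u).1 (val u).2)
  (fun u => U_((val u).2) *+ q + U_((val u).1))%MM.
Proof.
move=> [[i j] /= lt_ij] [[k l] /= lt_kl]; rewrite mcoeffB.
have -> := dual_frob_monomials K (j, i) (l, k).
have -> := dual_frob_monomials K (i, j) (l, k).
rewrite -val_eqE /= !xpair_eqE andbC; case: (i =P l) => [il|_];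
  last by rewrite subr0.
case: (j =P k) => [jk|_]; last by rewrite subr0.
by move: lt_ij lt_kl; rewrite il jk => /ltn_trans lt_kk /lt_kk; rewrite ltnn.
Qed.

Lemma frob_minors_span_card n m (D : 'I_m -> {mpoly K[n]})
    (T : 'I_n -> 'I_n -> 'I_m -> K) :
  (forall i j, frob_minor i j = \sum_l T i j l *: D l) -> ('C(n, 2) <= m)%N.
Proof.
move=> minorT; rewrite -card_ltn_pair; set P : finType := ltn_pair n.
pose A : 'M[K]_(#|P|, m) :=
  \matrix_(k, l) T (val (enum_val k : P)).1 (val (enum_val k : P)).2 l.
suff /eqP <- : row_free A by apply: rank_leq_col.
pose x (k : 'I_#|P|) := frob_minor (val (enum_val k)).1 (val (enum_val k)).2.
pose mon (k : 'I_#|P|) : 'X_{1..n} :=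
  (U_((val (enum_val k)).2) *+ q + U_((val (enum_val k)).1))%MM.
have dual_x : dual_monomials x mon.
  by move=> k l; rewrite [LHS]dual_frob_minors (inj_eq enum_val_inj).
apply: (dual_row_free dual_x (y := D)) => k; rewrite /x minorT.
by apply: eq_bigr => l _; rewrite mxE.
Qed.

Definition minor_cycle n (H : {mpoly K[n]}) (u v : option 'I_n) :
    {mpoly K[n]} :=
  match u, v with
  | Some i, Some j => frob_minor i j
  | None, Some j => H * 'X_j
  | Some i, None => - (H * 'X_i)
  | None, None => 0
  end.

Lemma minor_cycle_closed n d (F H : {mpoly K[n]}) v :
  F \is d.-homog -> d%:R = 0 :> K -> frob10 q F = H * F ->
  \sum_u minor_cycle H u v * jacobian_gen F u = 0.
Proof.
move=> homF d0 frobF; have := euler_homog homF; rewrite d0 scale0r => euler0.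
rewrite sum_option; case: v => [j|] /=; last first.
  rewrite mul0r add0r; under eq_bigr do rewrite mulNr -mulrA.
  by rewrite sumrN -mulr_sumr euler0 mulr0 oppr0.
under eq_bigr do rewrite mulrBl -mulrA mulrAC.
rewrite sumrB -mulr_sumr -mulr_suml euler0 mulr0 sub0r.
by rewrite -/(frob10 q F) frobF mulrAC subrr.
Qed.

Lemma frob_minors_combination n d (F H : {mpoly K[n]}) :
  F \is d.-homog -> smooth_hypersurface F -> d%:R = 0 :> K -> (q.+2 <= d)%N ->
  frob10 q F = H * F ->
  exists2 T : seq 'I_n -> K, alternating T &
    forall i j, frob_minor i j = \sum_(l | d == q.+2) T [:: l; i; j] *: F^`M(l).
Proof.
move=> homF smoothF d0 le_qd frobF.
have [M XM] := smooth_jacobian_power smoothF.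
have alt_cycle : alternating (fun_seq2 (minor_cycle H)).
  apply: alternating_fun_seq2 => [[i|]|[i|] [j|]] //=;
    rewrite /frob_minor ?subrr //.
  - by rewrite opprB.
  - by rewrite opprK.
  - by rewrite oppr0.
have [||v alt_v cycle_v] := koszul_mpoly_exact (d := 2) XM _ alt_cycle.
- by rewrite card_option card_ord.
- case=> [|u []] //= _; rewrite -[RHS](minor_cycle_closed u homF d0 frobF).
  by apply: eq_bigr => l _; rewrite mulrC.
exists (mcoeff 0 \o v \o map Some) => [|i j].
  exact/alternating_map/alternating_raddf.
have minor_v : frob_minor i j
    = \sum_l v [:: l; Some i; Some j] * jacobian_gen F l.
  rewrite -[LHS]/(fun_seq2 (minor_cycle H) [:: Some i; Some j]) cycle_v //.
  by apply: eq_bigr => l _; rewrite mulrC.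
rewrite (homogeneous_combination (dhomog_frob_minor i j)
  (fun l => dhomog_jacobian_gen l homF) _ minor_v) => [|[l|]]; last 2 first.
- by case: d le_qd {homF d0}.
- exact: ltnW.
rewrite big_mkcond sum_option /= gtn_eqF // add0r -big_mkcond.
by apply: eq_bigl => l; case: d le_qd {homF d0 minor_v}.
Qed.

End FrobeniusMinors.

Section SquareSubstitution.

Variables (K : fieldType) (n : nat).
Hypothesis two_eq0 : 2%:R = 0 :> K.
Implicit Types F G : {mpoly K[n]}.

HB.instance Definition _ :=
  GRing.RMorphism.copy (@sq_subst K n) (comp_mpoly [tuple 'X_i ^+ 2 | i < n]).

Lemma mderiv_sq_subst G i : (sq_subst G)^`M(i) = 0.
Proof.
rewrite mderiv_comp_mpoly big1 // => j _.
by rewrite tnth_mktuple mderiv_expr two_eq0 scale0r mulr0.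
Qed.

Lemma sq_substP F : (forall i, F^`M(i) = 0) -> exists G, F = sq_subst G.
Proof.
move=> dF0; have even_supp m i : m \in msupp F -> ~~ odd (m i).
  rewrite mcoeff_msupp; apply: contra => odd_mi.
  have le_im : (U_(i) <= m)%MM by rewrite lep1mP; case: (m i) odd_mi.
  have := congr1 (mcoeff (m - U_(i))%MM) (dF0 i).
  rewrite mcoeff0 mcoeff_deriv submK //.
  rewrite mnmBE mnm1E eqxx subn1 prednK; last by case: (m i) odd_mi.
  rewrite -mulr_natr -[m i]odd_double_half odd_mi natrD -muln2 natrM two_eq0.
  by rewrite mulr0 addr0 mulr1 => ->.
exists (\sum_(m <- msupp F) F@_m *: 'X_[[multinom (m i)./2 | i < n]]).
rewrite [LHS]mpolyE rmorph_sum /= big_seq [RHS]big_seq.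
apply: eq_bigr => m m_in.
rewrite /sq_subst comp_mpolyZ comp_mpolyX; congr (_ *: _).
rewrite mpolyXE_id; apply: eq_bigr => i _.
rewrite tnth_mktuple mnmE -exprM mul2n.
by rewrite even_halfK // even_supp.
Qed.

End SquareSubstitution.

Lemma inord3_neq m : [/\ inord 0 != inord 1 :> 'I_m.+3,
  inord 1 != inord 2 :> 'I_m.+3 & inord 2 != inord 0 :> 'I_m.+3].
Proof. by rewrite -!val_eqE /= !inordK. Qed.

Section TernaryForms.

Variable K : finFieldType.
Local Notation q := #|K|.

Definition ternary_core n (a b c : 'I_n) : {mpoly K[n]} :=
  'X_a * 'X_b * 'X_c * ('X_a ^+ (q - 1) + 'X_b ^+ (q - 1) + 'X_c ^+ (q - 1)).

Definition ternary_frobenius_form n (F : {mpoly K[n.+1]}) : Prop :=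
  exists (c : K) (G : {mpoly K[n.+1]}), c != 0 /\
    c *: F = ternary_core (inord 0) (inord 1) (inord 2) + sq_subst G.

Lemma ternary_coreE n (a b c : 'I_n) : ternary_core a b c
  = 'X_a ^+ q * ('X_b * 'X_c) + 'X_a * ('X_b ^+ q * 'X_c + 'X_b * 'X_c ^+ q).
Proof.
rewrite /ternary_core; have q_succ : (q = (q - 1).+1)%N.
  by rewrite subn1 prednK // ltnW // card_finField_gt1.
rewrite [in RHS]q_succ !exprS.
move: ('X_a ^+ _) ('X_b ^+ _) ('X_c ^+ _) => x y z.
by move: 'X_a 'X_b 'X_c => u v w; ring.
Qed.

Lemma ternary_core_rot n (a b c : 'I_n) :
  ternary_core b c a = ternary_core a b c.
Proof.
rewrite /ternary_core; move: ('X_a ^+ _) ('X_b ^+ _) ('X_c ^+ _) => x y z.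
by move: 'X_a 'X_b 'X_c => u v w; ring.
Qed.

Lemma frob_minor_char2 n (i j : 'I_n) : 2%:R = 0 :> K ->
  frob_minor K i j = 'X_i ^+ q * 'X_j + 'X_i * 'X_j ^+ q.
Proof.
move=> two_eq0; apply/eqP; rewrite -subr_eq0 /frob_minor.
rewrite (_ : _ - _ = - (2%:R * ('X_i ^+ q * 'X_j))); last by ring.
by rewrite mulr_natl -scaler_nat two_eq0 scale0r oppr0.
Qed.

Lemma mderiv_ternary_core n (a b c : 'I_n) :
  2%:R = 0 :> K -> b != a -> c != a ->
  (ternary_core a b c)^`M(a) = frob_minor K b c.
Proof.
move=> two_eq0 /negPf ba /negPf ca; rewrite frob_minor_char2 //.
rewrite ternary_coreE !(mderivD, mderivM) !mderiv_frob !mderivXU.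
by rewrite ba ca eqxx !(mul0r, mulr0, addr0, add0r, mul1r).
Qed.

Local Notation a := (inord 0 : 'I_3).
Local Notation b := (inord 1 : 'I_3).
Local Notation c := (inord 2 : 'I_3).

Lemma ord3_ind (P : 'I_3 -> Prop) : P a -> P b -> P c -> forall i, P i.
Proof.
by move=> Pa Pb Pc i; rewrite -(inord_val i); case: i => [[|[|[|i]]]].
Qed.

Lemma sum_ord3 (V : nmodType) (g : 'I_3 -> V) : \sum_l g l = g a + g b + g c.
Proof.
rewrite !big_ord_recl big_ord0 addr0 addrA.
by congr (g _ + g _ + g _); apply: val_inj; rewrite /= inordK.
Qed.

Lemma sum_alternating3 (V : lmodType K) (T : seq 'I_3 -> K) (D : 'I_3 -> V)
    i j k :
  alternating T -> uniq [:: i; j; k] ->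
  \sum_l T [:: l; j; k] *: D l = T [:: i; j; k] *: D i.
Proof.
move=> altT uniq_ijk; apply: big_only1 => // l ne _.
rewrite (alternating_nonuniq altT) ?scale0r //.
apply/negP => uniq_ljk; have /card_uniqP card4 : uniq [:: l; i; j; k].
  by move: uniq_ijk uniq_ljk;
    rewrite /= !inE !negb_or ne => /andP[-> ->] /andP[/andP[-> ->]].
by have := max_card (mem [:: l; i; j; k]); rewrite card4 card_ord.
Qed.

Lemma ternary_gradient (F : {mpoly K[3]}) (T : seq 'I_3 -> K) :
  alternating T ->
  (forall i j, frob_minor K i j = \sum_l T [:: l; i; j] *: F^`M(l)) ->
  exists2 t : K, t != 0 & [/\ t *: F^`M(a) = frob_minor K b c,
    t *: F^`M(b) = frob_minor K c a & t *: F^`M(c) = frob_minor K a b].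
Proof.
move=> altT minorT; have [_ TN] := altT.
have [ab bc ca] := inord3_neq 0.
have rotT i j k : T [:: j; k; i] = T [:: i; j; k].
  by rewrite (TN [:: j]) (TN [::]) opprK.
have minorE i j k : uniq [:: i; j; k] ->
    frob_minor K j k = T [:: i; j; k] *: F^`M(i).
  by move=> uniq_ijk; rewrite minorT (sum_alternating3 _ altT uniq_ijk).
have minor_bc : frob_minor K b c = T [:: a; b; c] *: F^`M(a).
  by rewrite (minorE a) //= !inE negb_or ab bc eq_sym ca.
exists (T [:: a; b; c]).
  by apply: contraNneq (frob_minor_neq0 K bc) => T0;
    rewrite minor_bc T0 scale0r.
split=> //; first by rewrite -rotT -minorE //= !inE negb_or bc ca eq_sym ab.
by rewrite -2!rotT -minorE //= !inE negb_or ca ab eq_sym bc.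
Qed.

Lemma ternary_frobenius_form_of_minors (F : {mpoly K[3]}) (T : seq 'I_3 -> K) :
  2%:R = 0 :> K -> alternating T ->
  (forall i j, frob_minor K i j = \sum_l T [:: l; i; j] *: F^`M(l)) ->
  frob10 q F = 0 /\ ternary_frobenius_form F.
Proof.
move=> two_eq0 altT /(ternary_gradient altT)[t t_neq0 [Fa Fb Fc]].
have [ab bc ca] := inord3_neq 0.
split.
  have /eqP : t *: frob10 q F = 0.
    by rewrite /frob10 sum_ord3 !scalerDr !scalerAr Fa Fb Fc /frob_minor; ring.
  by rewrite mscalerI (negPf t_neq0) => /eqP.
have [|G FG] := sq_substP two_eq0 (F := t *: F - ternary_core a b c).
  apply: ord3_ind; rewrite mderivB mderivZ ?Fa ?Fb ?Fc.
  - by rewrite mderiv_ternary_core ?subrr // eq_sym.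
  - by rewrite -ternary_core_rot mderiv_ternary_core ?subrr // eq_sym.
  - by rewrite -2!ternary_core_rot mderiv_ternary_core ?subrr // eq_sym.
by exists t, G; rewrite -FG addrC subrK.
Qed.

Lemma ternary_frobenius_form_degree d m (F : {mpoly K[m.+3]}) : (0 < d)%N ->
  F \is d.-homog -> 2%:R = 0 :> K -> ternary_frobenius_form F -> d = q.+2.
Proof.
move=> d_gt0 homF two_eq0 [t [G [_ FG]]].
pose i : 'I_m.+3 := inord 0; pose j : 'I_m.+3 := inord 1.
pose k : 'I_m.+3 := inord 2; have [ij jk ki] := inord3_neq m.
have minorE : t *: F^`M(i) = frob_minor K j k.
  rewrite -mderivZ FG mderivD mderiv_sq_subst // addr0.
  by rewrite mderiv_ternary_core // eq_sym.
have homFi : frob_minor K j k \is d.-1.-homog.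
  by rewrite -minorE; apply/rpredZ/dhomog_mderiv.
rewrite -(prednK d_gt0); congr _.+1.
exact: dhomog_uniq (frob_minor_neq0 K jk) homFi (dhomog_frob_minor K j k).
Qed.

End TernaryForms.

Theorem degree_ge_add2 (K : finFieldType) m d (F H : {mpoly K[m.+3]}) :
  F \is d.-homog -> smooth_hypersurface F -> frob10 #|K| F = H * F ->
  d%:R = 0 :> K -> (#|K|.+2 <= d)%N ->
  [/\ d = #|K|.+2, 2%:R = 0 :> K, m = 0%N, frob10 #|K| F = 0
    & ternary_frobenius_form F].
Proof.
move=> homF smoothF frobF d0 le_qd.
have [T altT minorT] := frob_minors_combination homF smoothF d0 le_qd frobF.
have def_d : d = #|K|.+2.
  apply: contraNeq (frob_minor_neq0 K (isT : (0 : 'I_m.+3) != 1)) =>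
    /negPf ne_d.
  by rewrite minorT ne_d big_pred0.
have two_eq0 : 2%:R = 0 :> K.
  by move: d0; rewrite def_d -addn2 natrD natr_card_finField add0r.
have {}minorT i j : frob_minor K i j = \sum_l T [:: l; i; j] *: F^`M(l).
  by rewrite minorT; apply: eq_bigl => l; apply/eqP.
have := frob_minors_span_card (T := fun i j l => T [:: l; i; j]) minorT.
rewrite !binS !bin1 bin0 => card_minors; have m0 : m = 0%N by lia.
case: m F H homF smoothF frobF T altT minorT m0 {card_minors} => // F H.
move=> _ _ _ T altT minorT _.
by have [] := ternary_frobenius_form_of_minors two_eq0 altT minorT.
Qed.

(** * Classification by degree *)

Section SmoothNonclassical.

Variables (K : finFieldType) (p m d : nat) (F : {mpoly K[m.+3]}).
Local Notation q := #|K|.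
Hypotheses (pcharK : p \in [pchar K]) (F_neq0 : F != 0) (homF : F \is d.-homog).
Hypotheses (d_gt0 : (0 < d)%N) (smoothF : smooth_hypersurface F).
Hypothesis nonclassicalF : frobenius_nonclassical q F.

Lemma degree_gt_succ : (q.+1 < d)%N ->
  [/\ d = q.+2, 2%:R = 0 :> K, m = 0%N, frob10 q F = 0
    & ternary_frobenius_form F].
Proof.
move=> lt_qd; have [H homH frobF] :=
  frob10_quotient_dhomog d_gt0 homF nonclassicalF.
apply: (degree_ge_add2 homF smoothF frobF) => //; apply/eqP.
apply: contraLR lt_qd => d_neq0.
rewrite -leqNgt.
exact: nonclassical_degree_le_succ homF smoothF d_neq0 homH frobF.
Qed.

Lemma degree_le_add2 : (d <= q + 2)%N.
Proof.
by rewrite addn2; case: (leqP d q.+1) => [/leqW|/degree_gt_succ[->]].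
Qed.

Lemma degree_succ_cases : d = q.+1 ->
  (odd m.+2 /\ skew_frobenius_form F)
  \/ [/\ ~~ odd m.+2, 2%:R = 0 :> K & singular_frobenius_form F].
Proof.
move=> def_d; have [H homH frobF] :=
  frob10_quotient_dhomog d_gt0 homF nonclassicalF.
by apply: degree_succ_dichotomy smoothF homH frobF; rewrite // -def_d.
Qed.

Lemma degree_succ_oddP : d = q.+1 /\ odd m.+2 <-> skew_frobenius_form F.
Proof.
split=> [[/degree_succ_cases[[]|[/negPf->]] //]|[A [skewA [detA FA]]]]; split.
  by apply: dhomog_uniq F_neq0 homF _; rewrite FA; apply: dhomog_frob_form.
by apply: contraNT detA => even_m; rewrite det_skew_zero_diag_odd // oddS.
Qed.

Lemma degree_succ_evenP :
  d = q.+1 /\ ~~ odd m.+2 <-> p = 2 /\ singular_frobenius_form F.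
Proof.
split=> [[/degree_succ_cases[[-> //]|[_ two_eq0 singF]] _]|].
  by split; first exact: pchar_eq2 two_eq0.
move=> [_ [M [_ [_ [G [B [_ [skewB [detB FGB]]]]]]]]]; split.
  by apply: (frob_form_tail_degree (G := G) _ _ detB);
    rewrite -?FGB ?dhomog_lin_subst.
by apply: contraNN detB => odd_m; rewrite det_skew_zero_diag_odd.
Qed.

Lemma degree_add2P :
  d = (q + 2)%N <-> p = 2 /\ m.+2 = 2 /\ ternary_frobenius_form F.
Proof.
rewrite addn2; split=> [def_d|[p2 [_ ternaryF]]].
  have [|_ two_eq0 m0 _ ternaryF] := degree_gt_succ; first by rewrite def_d.
  by split; [exact: pchar_eq2 two_eq0|split=> //; rewrite m0].
have two_eq0 : 2%:R = 0 :> K by have := pcharf0 pcharK; rewrite p2.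
exact: ternary_frobenius_form_degree ternaryF.
Qed.

Lemma frob10_eq0P : (d = q.+1 /\ odd m.+2) \/ d = (q + 2)%N <-> frob10 q F = 0.
Proof.
split=> [[/degree_succ_oddP[A [skewA [_ ->]]]|def_d]|frobF0].
- exact: frob10_frob_form.
- by have [] := degree_gt_succ; rewrite // def_d addn2.
have lt_qd : (q < d)%N by apply: frob10_eq0_degree homF smoothF frobF0.
case: (leqP d q.+1) => [le_dq|/degree_gt_succ[-> _ _ _ _]];
  last by right; rewrite addn2.
have def_d : d = q.+1 by apply/eqP; rewrite eqn_leq le_dq.
case: (degree_succ_cases def_d) => [[]|[_ _ [M [unitM [frobMF _]]]]];
  first by left.
move: frobMF; rewrite frob10_lin_subst frobF0 rmorph0 => /esym/eqP.
rewrite mulf_eq0 mpolyXn (negPf (mpolyX_neq0 _ _)) /= => /eqP MF0.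
case/eqP: F_neq0.
by rewrite -(lin_substK unitM F) MF0 rmorph0.
Qed.

End SmoothNonclassical.

Theorem theorem1p6 (K : finFieldType) (p q n d : nat)
  (hp : prime p) (hchar : p \in [pchar K]) (hq : #|K| = q)
  (hn : (2 <= n)%N) (F : {mpoly K[n.+1]})
  (hF0 : F != 0) (hFd : F \is d.-homog) (hd : (2 <= d)%N)
  (hsmooth : smooth_hypersurface F) (hnc : frobenius_nonclassical q F) :
  (d <= q + 2)%N /\
  (* (1) *)
  ((d = q.+1 /\ odd n) <->
     exists A : 'M[K]_(n.+1),
       skew_zero_diag A /\ \det A != 0 /\ F = frob_form q A) /\
  (* (2) *)
  ((d = q.+1 /\ ~~ odd n) <->
     (p = 2%N /\
      exists M : 'M[K]_(n.+1), M \in unitmx /\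
        frob10 q (lin_subst M F) = 'X_ord0 ^+ (q - 1) * lin_subst M F /\
        exists (G : {mpoly K[n.+1]}) (B : 'M[K]_n),
          G^`M(ord0) = 0 /\ skew_zero_diag B /\ \det B != 0 /\
          lin_subst M F = 'X_ord0 * G + frob_form_tail q B)) /\
  (* (3) *)
  (d = (q + 2)%N <->
     (p = 2%N /\ n = 2%N /\
      exists (c : K) (G : {mpoly K[n.+1]}), c != 0 /\
        c *: F = 'X_(inord 0) * 'X_(inord 1) * 'X_(inord 2) *
                   ('X_(inord 0) ^+ (q - 1) + 'X_(inord 1) ^+ (q - 1)
                    + 'X_(inord 2) ^+ (q - 1))
                 + sq_subst G)) /\
  (* final claim *)
  (((d = q.+1 /\ odd n) \/ d = (q + 2)%N) <-> frob10 q F = 0).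
Proof.
subst q; case: n hn F hF0 hFd hsmooth hnc =>
  [|[|m]] // _ F F_neq0 homF smoothF ncF.
have d_gt0 := ltnW hd.
split; first exact: degree_le_add2 homF d_gt0 smoothF ncF.
split; first exact: degree_succ_oddP.
split; first exact: degree_succ_evenP.
split; first exact: degree_add2P.
exact: frob10_eq0P.
Qed.
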